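(* Let $\mathbf{A}\in\mathbb{C}^{n\times n}$ be Hermitian with $\|\mathbf{A}\|\le1$ and eigenvalues $\lambda_1\le\dots\le\lambda_n$, let $k\in[n-1]$, $\mathrm{gap}_k=|\lambda_{k+1}-\lambda_k|$, $\mu_k=(\lambda_k+\lambda_{k+1})/2$, and let $\mathbf{P}=\frac12(\mathbf{I}+\mathrm{sgn}(\mu_k\mathbf{I}-\mathbf{A}))$ be the true density matrix (the orthogonal projector onto the span of eigenvectors of $\lambda_1,\dots,\lambda_k$). Let $\delta\in(0,1/12)$. Algorithm $\mathsf{DENSITY}(\mathbf{A},\delta,k)$: compute $(\widetilde\mu_k,\widetilde{\mathrm{gap}}_k)=\mathsf{FERMI}(\mathbf{A},\frac1{32},k)$; compute $\widetilde{\mathbf{A}}=\mathrm{fl}(\widetilde\mu_k\mathbf{I}-\mathbf{A})$; compute $\widetilde{\mathbf{P}}=\mathrm{fl}\big(\frac12(\mathbf{I}+\mathsf{SGN}(\widetilde{\mathbf{A}},\delta,\widetilde{\mathrm{gap}}_k/32))\big)$ and return it. Then $\|\widetilde{\mathbf{P}}-\mathbf{P}\|\le\delta$ with probability at least $1-O\big(\log(1/\mathrm{gap}_k)/n\big)$; the arithmetic complexity is $$O\Big(T_{\mathsf{MM}}(n)\Big(\log^2(\tfrac{n}{\mathrm{gap}_k})\log(\tfrac1{\mathrm{gap}_k})+\log\log(\tfrac1{\delta\,\mathrm{gap}_k})\Big)\Big),$$ and it requires $O\big(\log(n)\big(\log^3(\tfrac1{\mathrm{gap}_k})\log(\tfrac1{\delta\mathrm{gap}_k})+\log^4(\tfrac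 n{\mathrm{gap}_k})\big)\big)$ bits of precision.
   Context: Floating point model with unit roundoff $\mathbf{u}$: $\mathrm{fl}(a\odot b)=(1+\delta)(a\odot b)$, $|\delta|\le\mathbf{u}$. $T_{\mathsf{MM}}(n)=O(n^{\omega+\eta})$ is the cost of stable fast matrix multiplication; $\mu_{\mathsf{INV}}(n)$ and $c_{\mathsf{INV}}\le8$ are the stability parameters of a logarithmically-stable fast inversion algorithm. For diagonalizable $\mathbf{M}=\mathbf{V}\Lambda\mathbf{V}^{-1}$ with no eigenvalue on the imaginary axis, $\mathrm{sgn}(\mathbf{M})=\mathbf{V}\,\mathrm{sgn}(\Lambda)\mathbf{V}^{-1}$, with $\mathrm{sgn}$ of the real part on the diagonal. The $\epsilon$-pseudospectrum is $\Lambda_\epsilon(\mathbf{M})=\{\lambda:\|(\lambda\mathbf{I}-\mathbf{M})^{-1}\|>1/\epsilon\}$. For $\alpha\in(0,1)$ the Circles of Apollonius are $\mathsf{C}_\alpha=\mathsf{C}_\alpha^+\cup\mathsf{C}_\alpha^-$, $\mathsf{C}_\alpha^+=\{z:|\frac{1-z}{1+z}|\le\alpha\}$, $\mathsf{C}_\alpha^-=\{z:|\frac{1-z}{1+z}|^{-1}\le\alpha\}$. $\mathsf{SGN}(\mathbf{M},\delta,\epsilon)$ is a deterministic algorithm which, given $\delta\in(0,1/12)$ and $\epsilon\in(0,1)$ such that $\Lambda_\epsilon(\mathbf{M})\subset\mathsf{C}_\alpha$ for some $0<1-\alpha<1/100$, returns $\widetilde{\mathbf{S}}$ with $\|\widetilde{\mathbf{S}}-\mathrm{sgn}(\mathbf{M})\|\le\delta$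 provided $\mathbf{u}\le\alpha^{2^{N+1}(c_{\mathsf{INV}}\log n+3)}/(\mu_{\mathsf{INV}}(n)\sqrt nN)$, where $N=\lceil\log\frac1{1-\alpha}+3\log\log\frac1{1-\alpha}+\log\log\frac1{\delta\epsilon}+7.79\rceil$, using $O(NT_{\mathsf{MM}}(n))$ operations. $\mathsf{FERMI}(\mathbf{A},\epsilon,k)$: starting from $\delta'=1/2$, repeatedly compute additive-$\delta'$ approximations $\widetilde\lambda_1\le\dots\le\widetilde\lambda_n$ of all eigenvalues of $\mathbf{A}$ (by a randomized algorithm succeeding with probability $\ge1-17/n$, cost $O(T_{\mathsf{MM}}(n)\log^2(n/\delta'))$, $O(\log^4(n/\delta')\log n)$ bits), halving $\delta'$ until $\delta'\le\frac{\epsilon}{1+2\epsilon}|\widetilde\lambda_k-\widetilde\lambda_{k+1}|$, then return $\widetilde\mu_k=(\widetilde\lambda_k+\widetilde\lambda_{k+1})/2$ and $\widetilde{\mathrm{gap}}_k=|\widetilde\lambda_k-\widetilde\lambda_{k+1}|$.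
   Formalization: In the bounds, log(1/gap_k) and log(n/gap_k) are read as max(1, log2), since for gap_k ≥ 1 the literal bounds vanish or turn negative and fail (at gap_k = 1 they would claim success with probability 1); the cost bound is asserted on the success event. *)

(* Defs.v *)
From HB Require Import structures.
From mathcomp Require Import all_boot all_order all_algebra.
From mathcomp Require Import complex.
From mathcomp Require Import all_classical all_reals all_analysis.

Set Implicit Arguments.
Unset Strict Implicit.
Unset Printing Implicit Defensive.

Import Order.TTheory GRing.Theory Num.Theory.
Import numFieldNormedType.Exports.

Local Open Scope classical_set_scope.
Local Open Scope complex_scope.
Local Open Scope ring_scope.

Definition log2 (R : realType) (x : R) : R := ln x / ln 2.

(* Logarithm for the O(.) bounds in 1/gap and n/gap.  As the gap ranges over
   ]0, 2], log2 (1/gap) and log2 (n/gap) may vanish or be negative; the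
   truncation at 1 agrees with log2 x as soon as x >= 2. *)
Definition lg (R : realType) (x : R) : R := Num.max 1 (log2 x).

Section Matrices.
Variables (R : realType) (n : nat).
Implicit Types (A M S : 'M[R[i]]_n) (x : 'cV[R[i]]_n) (z : R[i]).

Definition cabs z : R := complex.Re `|z|.

Definition vnorm2 x : R := Num.sqrt (\sum_i cabs (x i 0) ^+ 2).

(* Spectral norm; the canonical norm on matrices of MathComp-Analysis is the
   entrywise maximum. *)
Definition opnorm M : R := sup [set vnorm2 (M *m x) | x in [set x | vnorm2 x <= 1]].

Definition sorted_eigenvalues A (lam : seq R) : Prop :=
  sorted <=%O lam /\ char_poly A = \prod_(l <- lam) ('X - (l%:C)%:P).

(* The norm of the resolvent is infinite at an eigenvalue, whereas invmx is the
   identity function on singular matrices. *)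
Definition pseudospectrum (eps : R) M : set R[i] :=
  [set z | z%:M - M \notin unitmx \/ eps^-1 < opnorm (invmx (z%:M - M))].

(* The side conditions exclude the points where the quotient, resp. its
   inverse, is infinite, since x / 0 = 0 here. *)
Definition apollonius_pos (alpha : R) : set R[i] :=
  [set z | z != - 1 /\ cabs ((1 - z) / (1 + z)) <= alpha].
Definition apollonius_neg (alpha : R) : set R[i] :=
  [set z | z != 1 /\ (cabs ((1 - z) / (1 + z)))^-1 <= alpha].
Definition apollonius (alpha : R) : set R[i] :=
  apollonius_pos alpha `|` apollonius_neg alpha.

(* M is diagonalizable without eigenvalue on the imaginary axis, and S = sgn M. *)
Definition is_sgn M S : Prop :=
  exists (V : 'M[R[i]]_n) (D : 'rV[R[i]]_n),
    [/\ V \in unitmx,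
        forall i, complex.Re (D 0 i) != 0,
        M = V *m diag_mx D *m invmx V
      & S = V *m diag_mx (\row_i (Num.sg (complex.Re (D 0 i)))%:C) *m invmx V].

End Matrices.

Inductive flop := FAdd | FSub | FMul | FDiv.

Definition flop_exact (R : realType) (o : flop) (a b : R) : R :=
  match o with
  | FAdd => a + b
  | FSub => a - b
  | FMul => a * b
  | FDiv => a / b
  end.

(* Floating point arithmetic on the reals with unit roundoff u; complex numbers
   are handled through their real and imaginary parts. *)
Record fparith (R : realType) (u : R) := FPArith {
  fl :> flop -> R -> R -> R ;
  flP : forall o a b, (o = FDiv -> b != 0) ->
    exists d : R, `|d| <= u /\ fl o a b = (1 + d) * flop_exact o a b }.

Definition bits_at_least (R : realType) (u p : R) : Prop := u <= 2 `^ (- p).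

(* The set E contains an event of probability at least p; for measurable E this
   is p <= P E. *)
Definition with_prob_at_least (R : realType) (d : measure_display)
    (W : measurableType d) (P : probability W R) (p : R) (E : set W) : Prop :=
  exists G : set W, [/\ measurable G, G `<=` E & (p%:E <= P G)%E].

(* Algorithms take the arithmetic they run on and return their output together
   with their number of arithmetic operations. *)
Definition sgn_alg (R : realType) : Type :=
  forall u : R, fparith u ->
  forall n, 'M[R[i]]_n -> R -> R -> 'M[R[i]]_n * nat.

(* The nat argument is the rank of the call, so that successive calls may use
   different parts of the random sample. *)
Definition eig_alg (R : realType) (W : Type) : Type :=
  forall u : R, fparith u -> nat -> W ->
  forall n, 'M[R[i]]_n -> R -> seq R * nat.

(* The lower bound: multiplication has n^2 outputs (and omega >= 2). *)
Definition mm_cost (R : realType) (omega eta : R) (T_MM : nat -> R) : Prop :=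
  exists2 c : R, 0 < c & forall n, (0 < n)%N ->
    n%:R ^+ 2 <= c * T_MM n /\ T_MM n <= c * n%:R `^ (omega + eta).

(* Logarithmically stable inversion has mu_INV(n) = poly(n). *)
Definition inv_params (R : realType) (mu_INV : nat -> R) (c_INV : R) : Prop :=
  0 <= c_INV <= 8 /\
  exists c e : R, forall n, (0 < n)%N -> 0 < mu_INV n <= c * n%:R `^ e.

Definition sgn_iters (R : realType) (alpha delta eps : R) : R :=
  (Num.ceil (log2 (1 - alpha)^-1 + 3 * log2 (log2 (1 - alpha)^-1)
             + log2 (log2 (delta * eps)^-1) + 779 / 100))%:~R.

Definition sgn_spec (R : realType) (T_MM mu_INV : nat -> R) (c_INV : R)
    (SGN : sgn_alg R) : Prop :=
  exists2 c : R, 0 < c &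
  forall (u : R) (fp : fparith u) (n : nat) (M S : 'M[R[i]]_n)
         (delta eps alpha : R),
  (0 < n)%N -> 0 < delta < 12^-1 -> 0 < eps < 1 -> 0 < 1 - alpha < 100^-1 ->
  pseudospectrum eps M `<=` apollonius alpha ->
  is_sgn M S ->
  let N := sgn_iters alpha delta eps in
  u <= alpha `^ (2 `^ (N + 1) * (c_INV * log2 n%:R + 3))
       / (mu_INV n * Num.sqrt n%:R * N) ->
  opnorm ((SGN u fp n M delta eps).1 - S) <= delta /\
  (SGN u fp n M delta eps).2%:R <= c * (N * T_MM n).

Definition eig_spec (R : realType) (d : measure_display) (W : measurableType d)
    (P : probability W R) (T_MM : nat -> R) (EIG : eig_alg R W) : Prop :=
  exists2 c : R, 0 < c &
  forall (u : R) (fp : fparith u) (t n : nat) (A : 'M[R[i]]_n) (lam : seq R)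
         (delta : R),
  (1 < n)%N -> A \is hermsymmx -> opnorm A <= 1 -> sorted_eigenvalues A lam ->
  0 < delta < 1 ->
  bits_at_least u (c * (log2 (n%:R / delta) ^+ 4 * log2 n%:R)) ->
  with_prob_at_least P (1 - 17 / n%:R)
    [set w | let out := EIG u fp t w n A delta in
       [/\ size out.1 = n, sorted <=%O out.1,
           forall i, (i < n)%N -> `|out.1`_i - lam`_i| <= delta
         & out.2%:R <= c * (T_MM n * log2 (n%:R / delta) ^+ 2)]].

Section Fermi.
Variables (R : realType) (u : R) (fs : fparith u).
Variables (eig : nat -> R -> seq R * nat) (eps : R) (k : nat).

(* The indices k, k+1 are 1-based, sequences are 0-based. *)
Definition fermi_gap (l : seq R) : R := `|fs FSub l`_k.-1 l`_k|.

Definition fermi_mid (l : seq R) : R := fs FDiv (fs FAdd l`_k.-1 l`_k) 2.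

Definition fermi_tol (l : seq R) : R :=
  fs FMul (fs FDiv eps (fs FAdd 1 (fs FMul 2 eps))) (fermi_gap l).

(* fermi_run t d (mu, gap, c): the loop entered with delta' = d at round t stops
   and returns (mu, gap) after c operations.  Besides the call to eig, a round
   costs 5 operations and one comparison, plus one halving if the loop goes on;
   the returned midpoint costs 2 operations. *)
Inductive fermi_run : nat -> R -> R * R * nat -> Prop :=
| FermiStop (t : nat) (d : R) :
    d <= fermi_tol (eig t d).1 ->
    fermi_run t d (fermi_mid (eig t d).1, fermi_gap (eig t d).1,
                   (eig t d).2 + 8)%N
| FermiNext (t : nat) (d mu gap : R) (c : nat) :
    fermi_tol (eig t d).1 < d ->
    fermi_run t.+1 (fs FDiv d 2) (mu, gap, c) ->
    fermi_run t d (mu, gap, (eig t d).2 + 7 + c)%N.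

Definition fermi : R * R * nat -> Prop := fermi_run 0 2^-1.

End Fermi.

Section Density.
Variables (R : realType) (u : R) (n : nat).
Implicit Types (fp fs : fparith u) (A S : 'M[R[i]]_n).

(* fl(mu I - A): the binary operations are the n real subtractions on the
   diagonal, the other entries only change sign, which is exact. *)
Definition fl_shift fp (mu : R) A : 'M[R[i]]_n :=
  \matrix_(i, j) if i == j
                 then fp FSub mu (complex.Re (A i j)) -i* complex.Im (A i j)
                 else - A i j.

(* fl((I + S) / 2): n real additions and 2 n^2 real multiplications. *)
Definition fl_half_addI fp S : 'M[R[i]]_n :=
  \matrix_(i, j)
    (fp FMul 2^-1 (if i == j then fp FAdd 1 (complex.Re (S i j))
                   else complex.Re (S i j))
     +i* fp FMul 2^-1 (complex.Im (S i j))).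

(* eig t d is the t-th computation of approximate eigenvalues of A, to within d.
   fp is the arithmetic of the matrix computations and fs the one of the scalar
   computations (those of FERMI and gap / 32): fs = fp rounds every operation,
   and an exact fs gives FERMI exactly as it is written.
   The relation is functional: out is the result of the terminating run. *)
Definition density_run fp fs (SGN : sgn_alg R)
    (eig : nat -> R -> seq R * nat)
    A (delta : R) (k : nat) (out : 'M[R[i]]_n * nat) : Prop :=
  exists (mu gap : R) (c : nat),
    fermi fs eig 32^-1 k (mu, gap, c) /\
    let S := SGN u fp n (fl_shift fp mu A) delta (fs FDiv gap 32) in
    out = (fl_half_addI fp S.1, c + n + 1 + S.2 + (n + 2 * n ^ 2))%N.

End Density.

(* Main.v *)
(** The unit roundoff is so small that polynomial losses in [n] and [1/gap] are
    harmless, which allows to measure perturbations in the Frobenius norm.  If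
    [X = V D V^*] and [Y = V' D' V'^*] are Hermitian and [W = V^* V'], then
    [V^* (X - Y) V'] has entries [(d_i - d'_j) W_ij] and [V^* (sgn X - sgn Y) V']
    has entries [(sgn d_i - sgn d'_j) W_ij].  Comparing the two gives at once the
    uniqueness of the sign, its Lipschitz continuity away from [0], and, since the
    columns of [W] are unit vectors, the stability of the eigenvalues.

    FERMI halves [delta'] until it is of order [gap], that is, during
    [O(log (1/gap))] rounds, whose failures are controlled by a union bound; its
    output is then within [gap/25] of the middle of the gap.  The
    [gap~/32]-pseudospectrum of the shifted matrix is made of discs around real
    eigenvalues of modulus between [2 gap/5] and [11/5], hence lies in the circles
    of Apollonius of parameter [1 - gap/400], and SGN applies. *)
Require Import Defs.
From HB Require Import structures.
From mathcomp Require Import all_boot all_order all_algebra.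
From mathcomp Require Import complex.
From mathcomp Require Import all_classical all_reals all_analysis.
From mathcomp Require Import ring lra.

Import Order.TTheory GRing.Theory Num.Theory.
Import numFieldNormedType.Exports.

Local Open Scope classical_set_scope.
Local Open Scope complex_scope.
Local Open Scope ring_scope.
Local Open Scope sesquilinear_scope.

Set Implicit Arguments.
Unset Strict Implicit.

(** * Modulus and matrix norms *)

Section Modulus.
Variable R : realType.
Implicit Types (z w : R[i]).

Lemma cabsE z : cabs z = Num.sqrt (complex.Re z ^+ 2 + complex.Im z ^+ 2).
Proof. by rewrite /cabs normc_def. Qed.

Lemma cabsC z : (cabs z)%:C = `|z|.
Proof. by rewrite /cabs normc_def. Qed.

Lemma cabs_ge0 z : 0 <= cabs z.
Proof. by rewrite cabsE sqrtr_ge0. Qed.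

Lemma cabs_sqr z : cabs z ^+ 2 = complex.Re z ^+ 2 + complex.Im z ^+ 2.
Proof. by rewrite cabsE sqr_sqrtr // addr_ge0 ?sqr_ge0. Qed.

Lemma cabsM z w : cabs (z * w) = cabs z * cabs w.
Proof. by apply: complexI; rewrite rmorphM /= !cabsC normrM. Qed.

Lemma cabsV z : cabs z^-1 = (cabs z)^-1.
Proof. by apply: complexI; rewrite fmorphV /= !cabsC normfV. Qed.

Lemma cabsN z : cabs (- z) = cabs z.
Proof. by rewrite /cabs normrN. Qed.

Lemma cabsD z w : cabs (z + w) <= cabs z + cabs w.
Proof. by rewrite -lecR rmorphD /= !cabsC ler_normD. Qed.

Lemma cabs_real (x : R) : cabs x%:C = `|x|.
Proof. by rewrite cabsE /= expr0n addr0 sqrtr_sqr. Qed.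

Lemma cabs0 : cabs 0 = 0 :> R.
Proof. by rewrite cabs_real normr0. Qed.

Lemma cabs1 : cabs 1 = 1 :> R.
Proof. by rewrite cabs_real normr1. Qed.

Lemma cabs_eq0 z : (cabs z == 0) = (z == 0).
Proof. by rewrite -(inj_eq (@complexI R)) cabsC normr_eq0. Qed.

Lemma normr_Re_le z : `|complex.Re z| <= cabs z.
Proof. by rewrite -lecR cabsC normc_ge_Re. Qed.

Lemma cabs_sum (I : finType) (F : I -> R[i]) :
  cabs (\sum_i F i) <= \sum_i cabs (F i).
Proof.
elim/big_ind2: _ => [|x a y b lex ley|//]; first by rewrite cabs0.
exact: le_trans (cabsD _ _) (lerD lex ley).
Qed.

Lemma cabs_sqr_conj z : (cabs z ^+ 2)%:C = z * z^*.
Proof. by rewrite rmorphXn /= cabsC sqr_normc. Qed.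

End Modulus.

(** Lagrange's identity: twice the difference of the two sides is the sum over all pairs of
    [(a i * b j - a j * b i) ^+ 2]. *)
Lemma sum_cauchy_schwarz (F : realDomainType) (I : finType) (a b : I -> F) :
  (\sum_i a i * b i) ^+ 2 <= (\sum_i a i ^+ 2) * (\sum_i b i ^+ 2).
Proof.
have E (f g : I -> F) : (\sum_i f i) * (\sum_j g j) = \sum_i \sum_j f i * g j.
  by rewrite mulr_suml; apply: eq_bigr => i _; rewrite mulr_sumr.
rewrite -(ler_pM2l (ltr0n _ 2)) !mulr_natl [leRHS]mulr2n expr2 !E.
rewrite [X in _ <= _ + X]exchange_big -big_split /= -sumrMnl ler_sum // => i _.
rewrite -sumrMnl -big_split ler_sum //= => j _.
rewrite -subr_ge0.
suff -> : a i ^+ 2 * b j ^+ 2 + a j ^+ 2 * b i ^+ 2 - a i * b i * (a j * b j) *+ 2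
  = (a i * b j - a j * b i) ^+ 2 by exact: sqr_ge0.
by ring.
Qed.

Section Frobenius.
Variable R : realType.

Definition frob2 (m n : nat) (M : 'M[R[i]]_(m, n)) : R :=
  \sum_i \sum_j cabs (M i j) ^+ 2.

Lemma frob2_ge0 m n (M : 'M[R[i]]_(m, n)) : 0 <= frob2 M.
Proof. by do 2!apply: sumr_ge0 => ? _; rewrite sqr_ge0. Qed.

(** In trace form, unitary invariance on either side reduces to cyclicity of the trace and
    [U^* U = 1]. *)
Lemma frob2_tr m n (M : 'M[R[i]]_(m, n)) : (frob2 M)%:C = \tr (M *m M^t*).
Proof.
rewrite /frob2 rmorph_sum; apply: eq_bigr => i _; rewrite mxE rmorph_sum.
by apply: eq_bigr => j _; rewrite !mxE; exact: cabs_sqr_conj.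
Qed.

Lemma frob2_unitaryl m n (U : 'M[R[i]]_m) (M : 'M[R[i]]_(m, n)) :
  U \is unitarymx -> frob2 (U *m M) = frob2 M.
Proof.
move=> Uu; apply: complexI; rewrite !frob2_tr trmx_mul map_mxM /= mulmxA.
by rewrite mxtrace_mulC !mulmxA -(invmx_unitary Uu) mulVmx ?unitarymx_unit // mul1mx.
Qed.

Lemma frob2_unitaryr m n (U : 'M[R[i]]_n) (M : 'M[R[i]]_(m, n)) :
  U \is unitarymx -> frob2 (M *m U) = frob2 M.
Proof.
move=> Uu; apply: complexI; rewrite !frob2_tr trmx_mul map_mxM /= mulmxA.
by rewrite mulmxtVK.
Qed.

Lemma frob2M m n p (A : 'M[R[i]]_(m, n)) (B : 'M[R[i]]_(n, p)) :
  frob2 (A *m B) <= frob2 A * frob2 B.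
Proof.
rewrite /frob2 mulr_suml ler_sum // => i _.
rewrite [in leRHS]exchange_big mulr_sumr ler_sum // => j _.
rewrite mxE; apply: le_trans (sum_cauchy_schwarz _ _).
rewrite ler_pXn2r ?nnegrE ?cabs_ge0 ?sumr_ge0 // => [|l _].
  by apply: le_trans (cabs_sum _) _; rewrite ler_sum // => l _; rewrite cabsM.
by rewrite mulr_ge0 ?cabs_ge0.
Qed.

Lemma frob2_entry m n (M : 'M[R[i]]_(m, n)) i j : cabs (M i j) ^+ 2 <= frob2 M.
Proof.
rewrite /frob2 (bigD1 i) //= (bigD1 j) //= -addrA lerDl addr_ge0 //.
  by apply: sumr_ge0 => ? _; rewrite sqr_ge0.
by do 2!apply: sumr_ge0 => ? _; rewrite sqr_ge0.
Qed.

Lemma frob2_le m n (M : 'M[R[i]]_(m, n)) c :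
  (forall i j, cabs (M i j) <= c) -> frob2 M <= (m * n)%:R * c ^+ 2.
Proof.
move=> Mc; rewrite /frob2 natrM.
apply: (@le_trans _ _ (\sum_(i < m) \sum_(j < n) c ^+ 2)).
  do 2!apply: ler_sum => ? _.
  by rewrite ler_pXn2r ?nnegrE ?cabs_ge0 // (le_trans (cabs_ge0 _) (Mc _ _)).
by rewrite !sumr_const !card_ord -mulrnA mulnC -natrM mulr_natl.
Qed.

End Frobenius.

Section OperatorNorm.
Variables (R : realType) (n : nat).
Implicit Types (x y : 'cV[R[i]]_n) (M N : 'M[R[i]]_n).

Lemma vnorm2E x : vnorm2 x = Num.sqrt (frob2 x).
Proof. by rewrite /vnorm2 /frob2; congr Num.sqrt; apply: eq_bigr => i _; rewrite big_ord1. Qed.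

Lemma vnorm2_sqr x : vnorm2 x ^+ 2 = frob2 x.
Proof. by rewrite vnorm2E sqr_sqrtr // frob2_ge0. Qed.

Lemma vnorm2_ge0 x : 0 <= vnorm2 x.
Proof. by rewrite vnorm2E sqrtr_ge0. Qed.

Lemma vnorm2_0 : vnorm2 (0 : 'cV[R[i]]_n) = 0.
Proof.
rewrite /vnorm2 big1 ?sqrtr0 // => i _.
by rewrite mxE cabs0 expr0n.
Qed.

Lemma vnorm2_entry x i : cabs (x i 0) <= vnorm2 x.
Proof.
rewrite -(ler_pXn2r (n := 2)) ?nnegrE ?cabs_ge0 ?vnorm2_ge0 // vnorm2_sqr.
exact: frob2_entry.
Qed.

Lemma vnorm2_eq0 x : vnorm2 x = 0 -> x = 0.
Proof.
move=> x0; apply/matrixP => i j; rewrite ord1 mxE; apply/eqP.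
by rewrite -cabs_eq0 eq_le cabs_ge0 andbT -x0 vnorm2_entry.
Qed.

Lemma vnorm2_delta i : vnorm2 (delta_mx i 0 : 'cV[R[i]]_n) = 1.
Proof.
rewrite /vnorm2 (bigD1 i) //= big1 => [|j ne].
  by rewrite addr0 mxE !eqxx cabs1 expr1n sqrtr1.
by rewrite mxE (negPf ne) cabs0 expr0n.
Qed.

Lemma vnorm2Z (c : R[i]) x : vnorm2 (c *: x) = cabs c * vnorm2 x.
Proof.
rewrite /vnorm2; under eq_bigr do rewrite mxE cabsM exprMn.
by rewrite -mulr_sumr sqrtrM ?sqr_ge0 // sqrtr_sqr ger0_norm ?cabs_ge0.
Qed.

Lemma vnorm2D x y : vnorm2 (x + y) <= vnorm2 x + vnorm2 y.
Proof.
have cs : \sum_i cabs (x i 0) * cabs (y i 0) <= vnorm2 x * vnorm2 y.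
  apply: le_trans (ler_norm _) _.
  rewrite -sqrtr_sqr -sqrtrM ?ler_wsqrtr ?sum_cauchy_schwarz //.
  by apply: sumr_ge0 => ? _; rewrite sqr_ge0.
rewrite -(ler_pXn2r (n := 2)) ?nnegrE ?addr_ge0 ?vnorm2_ge0 //.
rewrite sqrrD.
have sq z : vnorm2 z ^+ 2 = \sum_i cabs (z i 0) ^+ 2.
  by rewrite /vnorm2 sqr_sqrtr // sumr_ge0 // => ? _; rewrite sqr_ge0.
rewrite !sq.
apply: (@le_trans _ _ (\sum_i (cabs (x i 0) + cabs (y i 0)) ^+ 2)).
  apply: ler_sum => i _; rewrite mxE ler_pXn2r ?nnegrE ?addr_ge0 ?cabs_ge0 //.
  exact: cabsD.
under eq_bigr do rewrite sqrrD.
rewrite !big_split /= lerD2r lerD2l mulr2n.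
exact: lerD.
Qed.

Lemma vnorm2_mulmx_frob M x : vnorm2 (M *m x) <= Num.sqrt (frob2 M) * vnorm2 x.
Proof. by rewrite !vnorm2E -sqrtrM ?frob2_ge0 // ler_wsqrtr ?frob2M. Qed.

(** [sup] takes a default value on an unbounded set; boundedness by the Frobenius norm is what makes
    [opnorm] a genuine supremum. *)
Lemma opnorm_has_sup M :
  has_sup [set vnorm2 (M *m x) | x in [set x | vnorm2 x <= 1]].
Proof.
split; first by exists (vnorm2 (M *m 0)), 0 => //=; rewrite vnorm2_0 ler01.
exists (Num.sqrt (frob2 M)) => _ [x /= x1 <-].
apply: le_trans (vnorm2_mulmx_frob _ _) _.
by rewrite ler_piMr // sqrtr_ge0.
Qed.

Lemma opnorm_le M c :
  (forall x, vnorm2 x <= 1 -> vnorm2 (M *m x) <= c) -> opnorm M <= c.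
Proof.
move=> Mc; apply: ge_sup; first by case: (opnorm_has_sup M).
by move=> _ [x /= x1 <-]; exact: Mc.
Qed.

Lemma vnorm2_le_opnorm M x : vnorm2 x <= 1 -> vnorm2 (M *m x) <= opnorm M.
Proof.
by move=> x1; apply: ub_le_sup; [case: (opnorm_has_sup M) | exists x].
Qed.

Lemma vnorm2_mulmx M x : vnorm2 (M *m x) <= opnorm M * vnorm2 x.
Proof.
have [x0|x0] := eqVneq (vnorm2 x) 0.
  by rewrite (vnorm2_eq0 x0) mulmx0 vnorm2_0 mulr0.
have xgt0 : 0 < vnorm2 x by rewrite lt_def x0 vnorm2_ge0.
pose c : R[i] := ((vnorm2 x)^-1)%:C.
have cE : cabs c = (vnorm2 x)^-1 by rewrite cabs_real ger0_norm // invr_ge0 ltW.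
rewrite -ler_pdivrMr // mulrC -cE -vnorm2Z scalemxAr.
by apply: vnorm2_le_opnorm; rewrite vnorm2Z cE mulVf.
Qed.

Lemma opnorm_entry M i j : cabs (M i j) <= opnorm M.
Proof.
have := vnorm2_mulmx M (delta_mx j 0); rewrite vnorm2_delta mulr1.
apply: le_trans; have := vnorm2_entry (M *m delta_mx j 0) i.
by rewrite -colE mxE.
Qed.

Lemma opnorm_le_frob M c : 0 <= c -> frob2 M <= c ^+ 2 -> opnorm M <= c.
Proof.
move=> c0 Mc; apply: opnorm_le => x x1.
apply: le_trans (vnorm2_mulmx_frob M x) _.
rewrite -[c]mulr1 ler_pM ?sqrtr_ge0 ?vnorm2_ge0 //.
by rewrite -[c]ger0_norm // -sqrtr_sqr ler_wsqrtr.
Qed.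

Lemma opnormD M N : opnorm (M + N) <= opnorm M + opnorm N.
Proof.
apply: opnorm_le => x x1; rewrite mulmxDl; apply: le_trans (vnorm2D _ _) _.
by apply: lerD; exact: vnorm2_le_opnorm.
Qed.

Lemma opnormZ_le (c : R[i]) M b : opnorm M <= b -> opnorm (c *: M) <= cabs c * b.
Proof.
move=> Mb; apply: opnorm_le => x x1; rewrite -scalemxAl vnorm2Z.
rewrite ler_wpM2l ?cabs_ge0 //; apply: le_trans Mb.
exact: vnorm2_le_opnorm.
Qed.

End OperatorNorm.

Lemma unitary_mul_adj (R : realType) n (U : 'M[R[i]]_n) :
  U \is unitarymx -> U *m U^t* = 1%:M.
Proof. by move/unitarymxP. Qed.

Lemma unitary_adj_mul (R : realType) n (U : 'M[R[i]]_n) :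
  U \is unitarymx -> U^t* *m U = 1%:M.
Proof. by move=> Uu; rewrite -(invmx_unitary Uu) mulVmx ?unitarymx_unit. Qed.

Lemma opnorm_unitary_diag (R : realType) n (U : 'M[R[i]]_n) (D : 'rV[R[i]]_n) (c : R) :
  U \is unitarymx -> 0 <= c -> (forall i, cabs (D 0 i) <= c) ->
  opnorm (U *m diag_mx D *m U^t*) <= c.
Proof.
move=> Uu c0 Dc; apply: opnorm_le => x x1.
rewrite -!mulmxA vnorm2E frob2_unitaryl // -[c]mulr1.
apply: le_trans (_ : c * vnorm2 x <= _); last by rewrite ler_wpM2l.
rewrite vnorm2E -(@frob2_unitaryl _ _ _ (U^t*) x) ?trmxC_unitary //.
rewrite -[X in X * _]ger0_norm // -sqrtr_sqr -sqrtrM ?sqr_ge0 // ler_wsqrtr //.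
rewrite /frob2 mulr_sumr ler_sum // => i _; rewrite mulr_sumr ler_sum // => j _.
rewrite mul_diag_mx mxE cabsM exprMn ler_wpM2r ?sqr_ge0 //.
by rewrite ler_pXn2r ?nnegrE ?cabs_ge0.
Qed.

(** * Hermitian matrices in a unitary eigenbasis *)

(** The eigenvalues [l] are real, so these are exactly the Hermitian matrices when [U] is unitary;
    eigenvectors are the columns of [U]. *)
Definition unitary_diag (R : realType) n (U : 'M[R[i]]_n) (l : 'I_n -> R) : 'M[R[i]]_n :=
  U *m diag_mx (\row_i (l i)%:C) *m U^t*.

Lemma hermitian_unitary_diag (R : realType) n (A : 'M[R[i]]_n) :
  A \is hermsymmx ->
  exists (U : 'M[R[i]]_n) (l : 'I_n -> R), U \is unitarymx /\ A = unitary_diag U l.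
Proof.
(* The spectral theorem reads [A = P^-1 D P] with [P = spectralmx A], hence the adjoint. The
   diagonal of a Hermitian matrix is real in this basis, so taking real parts loses nothing. *)
move=> hA; exists ((spectralmx A)^t*), (fun i => complex.Re (spectral_diag A 0 i)).
rewrite trmxC_unitary spectral_unitarymx; split=> //.
have /orthomx_spectralP {1}-> := hermitian_normalmx hA.
rewrite /unitary_diag trmxCK (invmx_unitary (spectral_unitarymx A)).
congr (_ *m diag_mx _ *m _); apply/rowP => i; rewrite !mxE RRe_real //.
exact: (mxOverP (hermitian_spectral_diag_real hA)).
Qed.

Section UnitaryDiag.
Variables (R : realType) (n : nat).
Implicit Types (U V A M S : 'M[R[i]]_n) (l : 'I_n -> R).

Lemma scalar_sub_unitary_diag U l (z : R[i]) : U \is unitarymx ->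
  z%:M - unitary_diag U l = U *m diag_mx (\row_i (z - (l i)%:C)) *m U^t*.
Proof.
move=> Uu.
have -> : diag_mx (\row_i (z - (l i)%:C)) = z%:M - diag_mx (\row_i (l i)%:C).
  apply/matrixP => i j; rewrite !mxE; case: eqP => //=; by rewrite ?mulr0n ?subr0.
rewrite mulmxBr mulmxBl /unitary_diag; congr (_ - _).
by rewrite mul_mx_scalar -scalemxAl (unitary_mul_adj Uu) scalemx1.
Qed.

Lemma shift_unitary_diag U l (m : R) : U \is unitarymx ->
  m%:C%:M - unitary_diag U l = unitary_diag U (fun i => m - l i).
Proof.
move=> Uu; rewrite (scalar_sub_unitary_diag _ _ Uu) /unitary_diag.
congr (_ *m diag_mx _ *m _); apply/rowP => i; by rewrite !mxE rmorphB.
Qed.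

Lemma is_sgn_unitary_diag U l : U \is unitarymx -> (forall i, l i != 0) ->
  is_sgn (unitary_diag U l) (unitary_diag U (fun i => Num.sg (l i))).
Proof.
move=> Uu l0; exists U, (\row_i (l i)%:C).
rewrite (invmx_unitary Uu) (unitarymx_unit Uu); split=> [//||//|].
  by move=> i; rewrite mxE /=.
congr (_ *m diag_mx _ *m _); apply/rowP => i; by rewrite !mxE.
Qed.

(* In the two eigenbases, commutation reads [d i * W i j = W i j * l j], so the
   signs agree wherever the change of basis [W] does not vanish. *)
Lemma is_sgn_unitary_diag_eq U l S : U \is unitarymx ->
  is_sgn (unitary_diag U l) S -> S = unitary_diag U (fun i => Num.sg (l i)).
Proof.
move=> Uu [V [D [Vu _ ME ->]]].
have [W WE] : exists W, W = invmx V *m U by exists (invmx V *m U).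
have VW : V *m W = U by rewrite WE mulmxA mulmxV // mul1mx.
have DW : diag_mx D *m W = W *m diag_mx (\row_i (l i)%:C).
  rewrite -[LHS]mul1mx -(mulVmx Vu) WE -!mulmxA.
  rewrite (mulmxA (diag_mx D)) (mulmxA V) (mulmxA V) -ME /unitary_diag.
  by rewrite -(mulmxA (U *m _)) (unitary_adj_mul Uu) mulmx1.
have SW : diag_mx (\row_i (Num.sg (complex.Re (D 0 i)))%:C) *m W =
          W *m diag_mx (\row_i (Num.sg (l i))%:C).
  apply/matrixP => i j; have /matrixP/(_ i j) := DW.
  rewrite !mul_diag_mx !mul_mx_diag !mxE mulrC.
  have [-> _|W0] := eqVneq (W i j) 0; first by rewrite mulr0 mul0r.
  by move/(mulfI W0) => ->; rewrite mulrC.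
have -> : unitary_diag U (fun i => Num.sg (l i))
    = V *m (W *m diag_mx (\row_i (Num.sg (l i))%:C)) *m U^t* by rewrite mulmxA VW.
by rewrite -SW WE !mulmxA -[RHS]mulmxA (unitary_mul_adj Uu) mulmx1.
Qed.

Lemma frob2_unitary_diagB U V l m : U \is unitarymx -> V \is unitarymx ->
  frob2 (unitary_diag U l - unitary_diag V m) =
  \sum_i \sum_j (l i - m j) ^+ 2 * cabs ((U^t* *m V) i j) ^+ 2.
Proof.
move=> Uu Vu.
have Uu' : U^t* \is unitarymx by rewrite trmxC_unitary.
rewrite -(frob2_unitaryl _ Uu') -(frob2_unitaryr _ Vu).
rewrite /unitary_diag mulmxBr mulmxBl !mulmxA (unitary_adj_mul Uu) mul1mx.
rewrite -[X in _ - X]mulmxA (unitary_adj_mul Vu) mulmx1 -mulmxA.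
apply: eq_bigr => i _; apply: eq_bigr => j _.
rewrite mul_diag_mx mul_mx_diag !mxE mulrC -mulrBr cabsM -rmorphB cabs_real.
by rewrite exprMn real_normK ?num_real // mulrC.
Qed.

(** For equal signs the left side vanishes; for opposite signs the signs differ by 2, while [x] and
    [y] are at least [2 * g] apart. *)
Lemma sqr_subr_sg (g x y : R) : 0 < g -> g <= `|x| -> g <= `|y| ->
  (Num.sg x - Num.sg y) ^+ 2 * g ^+ 2 <= (x - y) ^+ 2.
Proof.
move=> g0.
have [x0|x0|->] := ltgtP x 0; last by rewrite normr0 => /(lt_le_trans g0); rewrite ltxx.
- rewrite (ltr0_norm x0) (ltr0_sg x0) => gx.
  have [y0|y0|->] := ltgtP y 0; last by rewrite normr0 => /(lt_le_trans g0); rewrite ltxx.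
  + by rewrite ltr0_sg // subrr expr0n mul0r sqr_ge0.
  + rewrite (gtr0_norm y0) (gtr0_sg y0) => gy; rewrite -exprMn -sqrrN -[leRHS]sqrrN.
    by rewrite ler_pXn2r ?nnegrE //; lra.
- rewrite (gtr0_norm x0) (gtr0_sg x0) => gx.
  have [y0|y0|->] := ltgtP y 0; last by rewrite normr0 => /(lt_le_trans g0); rewrite ltxx.
  + rewrite (ltr0_norm y0) (ltr0_sg y0) => gy; rewrite -exprMn.
    by rewrite ler_pXn2r ?nnegrE //; lra.
  + by rewrite gtr0_sg // subrr expr0n mul0r sqr_ge0.
Qed.

(** Termwise comparison of the two double sums given by [frob2_unitary_diagB]: away from 0 the sign
    is Lipschitz with constant [1 / g] in the Frobenius norm. *)
Lemma frob2_sgB U V l m g : U \is unitarymx -> V \is unitarymx -> 0 < g ->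
  (forall i, g <= `|l i|) -> (forall i, g <= `|m i|) ->
  g ^+ 2 * frob2 (unitary_diag U (fun i => Num.sg (l i))
                  - unitary_diag V (fun i => Num.sg (m i)))
  <= frob2 (unitary_diag U l - unitary_diag V m).
Proof.
move=> Uu Vu g0 gl gm; rewrite !(frob2_unitary_diagB _ _ Uu Vu) mulr_sumr.
apply: ler_sum => i _; rewrite mulr_sumr; apply: ler_sum => j _.
by rewrite mulrA (mulrC (g ^+ 2)) ler_wpM2r ?sqr_ge0 // sqr_subr_sg.
Qed.

(** Column [j] of the unitary matrix [U^* V] has squared moduli summing to 1, so the squared
    Frobenius distance is at least a weighted mean over [i] of [(l i - m j) ^+ 2], and some term
    does not exceed that mean. *)
Lemma unitary_diag_near U V l m (j : 'I_n) : U \is unitarymx -> V \is unitarymx ->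
  exists i, (l i - m j) ^+ 2 <= frob2 (unitary_diag U l - unitary_diag V m).
Proof.
move=> Uu Vu; apply/not_existsP => far.
set c := frob2 _ in far.
have W1 : \sum_i cabs ((U^t* *m V) i j) ^+ 2 = 1.
  have : frob2 ((U^t* *m V) *m delta_mx j 0 : 'cV_n) = 1.
    have Wu : U^t* *m V \is unitarymx by rewrite mul_unitarymx ?trmxC_unitary.
    rewrite (frob2_unitaryl _ Wu).
    by rewrite -vnorm2_sqr vnorm2_delta expr1n.
  by move=> <-; rewrite -colE; apply: eq_bigr => i _; rewrite big_ord1 [in RHS]mxE.
have : c * 1 < c; last by rewrite mulr1 ltxx.
rewrite -{1}W1 mulr_sumr {2}/c !(frob2_unitary_diagB _ _ Uu Vu) exchange_big [ltRHS](bigD1 j) //=.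
apply: ltr_wpDr.
  by do 2!apply: sumr_ge0 => ? _; rewrite mulr_ge0 ?sqr_ge0.
have pt i : c * cabs ((U^t* *m V) i j) ^+ 2 <= (l i - m j) ^+ 2 * cabs ((U^t* *m V) i j) ^+ 2.
  by rewrite ler_wpM2r ?sqr_ge0 //; move/negP: (far i); rewrite -ltNge => /ltW.
(* The contradiction needs a strict inequality, which comes from an index of nonzero weight; one
   exists since the weights sum to 1. *)
have [i Wi|W0] := pickP (fun i => cabs ((U^t* *m V) i j) != 0).
  rewrite (bigD1 i) // [ltRHS](bigD1 i) //= ltr_leD ?ler_sum //.
  rewrite ltr_pM2r ?exprn_gt0 ?lt_def ?Wi ?cabs_ge0 //.
  by move/negP: (far i); rewrite -ltNge lt_def.
move: W1; rewrite big1 => [/esym/eqP|i _]; first by rewrite oner_eq0.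
by have /negbFE/eqP -> := W0 i; rewrite expr0n.
Qed.

(** By contraposition: when [z] is at distance at least [eps] from every eigenvalue, the resolvent
    is explicit in the eigenbasis and has norm at most [eps^-1]. *)
Lemma pseudospectrum_unitary_diag U l (eps : R) (z : R[i]) : U \is unitarymx ->
  0 < eps -> pseudospectrum eps (unitary_diag U l) z ->
  exists i, cabs (z - (l i)%:C) < eps.
Proof.
move=> Uu e0 zP; apply/not_existsP => far.
have {}far i : eps <= cabs (z - (l i)%:C) by rewrite leNgt; apply/negP.
pose E := U *m diag_mx (\row_i (z - (l i)%:C)^-1) *m U^t*.
have ME : (z%:M - unitary_diag U l) *m E = 1%:M.
  rewrite (scalar_sub_unitary_diag _ _ Uu) /E !mulmxA -(mulmxA _ (U^t*) U) (unitary_adj_mul Uu).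
  rewrite mulmx1 -(mulmxA U) mulmx_diag.
  rewrite (_ : diag_mx _ = 1%:M) ?mulmx1 ?(unitary_mul_adj Uu) //.
  apply/matrixP => i j; rewrite !mxE divff // -cabs_eq0 gt_eqF //.
  exact: lt_le_trans (far i).
have Mu : z%:M - unitary_diag U l \in unitmx by case/mulmx1_unit: ME.
case: zP => [|]; first by rewrite Mu.
have -> : invmx (z%:M - unitary_diag U l) = E.
  by rewrite -[LHS]mulmx1 -ME mulmxA mulVmx // mul1mx.
apply/negP; rewrite -leNgt; apply: opnorm_unitary_diag => // [|i].
  by rewrite invr_ge0 ltW.
rewrite mxE cabsV lef_pV2 ?posrE //.
exact: lt_le_trans (far i).
Qed.

Lemma eigenvalue_sorted A (lam : seq R) (x : R) :
  sorted_eigenvalues A lam -> eigenvalue A x%:C = (x \in lam).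
Proof.
move=> [_ cE]; rewrite eigenvalue_root_char cE.
have -> : \prod_(y <- lam) ('X - (y%:C)%:P) = \prod_(z <- [seq y%:C | y <- lam]) ('X - z%:P).
  by rewrite big_map.
by rewrite root_prod_XsubC mem_map //; exact: complexI.
Qed.

(** Row [i] of [U^*] is a left eigenvector for [l i]. *)
Lemma unitary_diag_mem U l (lam : seq R) : U \is unitarymx ->
  sorted_eigenvalues (unitary_diag U l) lam -> forall i, l i \in lam.
Proof.
move=> Uu lamE i.
rewrite -(eigenvalue_sorted _ lamE); apply/eigenvalueP; exists (row i (U^t*)).
  rewrite -row_mul /unitary_diag !mulmxA (unitary_adj_mul Uu) mul1mx.
  by apply/rowP => j; rewrite mul_diag_mx !mxE.
apply/eqP => r0; have /rowP/(_ i) := row1 R[i] i.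
rewrite -(unitary_adj_mul Uu) row_mul r0 mul0mx !mxE !eqxx => /esym/eqP.
by rewrite oner_eq0.
Qed.

(** A left eigenvector for [x], written in the basis [U], is fixed up to the factor [x] by the
    diagonal matrix; any nonzero coordinate [i] then forces [l i = x]. *)
Lemma mem_unitary_diag U l (lam : seq R) : U \is unitarymx ->
  sorted_eigenvalues (unitary_diag U l) lam -> forall x, x \in lam -> exists i, l i = x.
Proof.
move=> Uu lamE x xl.
have : eigenvalue (unitary_diag U l) x%:C by rewrite (eigenvalue_sorted _ lamE).
move=> /eigenvalueP [v vE v0].
have [w wU] : exists w, w = v *m U by exists (v *m U).
have w0 : w != 0.
  apply: contraNneq v0 => w0.
  by rewrite -[v]mulmx1 -(unitary_mul_adj Uu) mulmxA -wU w0 mul0mx.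
have wE : w *m diag_mx (\row_i (l i)%:C) = x%:C *: w.
  rewrite wU scalemxAl -vE /unitary_diag !mulmxA -(mulmxA _ (U^t*)).
  by rewrite (unitary_adj_mul Uu) mulmx1.
have [i wi|w0'] := pickP (fun i => w 0 i != 0).
  exists i; have /rowP/(_ i) := wE; rewrite mul_mx_diag !mxE mulrC.
  by move/(mulIf wi) => [].
case/eqP: w0; apply/rowP => i; rewrite mxE; exact/eqP/negbFE/w0'.
Qed.

(** Column [i] of [U] is a unit eigenvector. *)
Lemma unitary_diag_eig_le U l : U \is unitarymx ->
  forall i, `|l i| <= opnorm (unitary_diag U l).
Proof.
move=> Uu i; pose x : 'cV[R[i]]_n := U *m delta_mx i 0.
have x1 : vnorm2 x = 1 by rewrite vnorm2E (frob2_unitaryl _ Uu) -vnorm2E vnorm2_delta.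
have := vnorm2_mulmx (unitary_diag U l) x; rewrite x1 mulr1.
suff -> : unitary_diag U l *m x = (l i)%:C *: x by rewrite vnorm2Z x1 cabs_real mulr1.
rewrite /unitary_diag /x !mulmxA -(mulmxA _ _ U) (unitary_adj_mul Uu) mulmx1.
rewrite -mulmxA scalemxAr; congr (_ *m _); apply/colP => j.
rewrite mul_diag_mx !mxE andbT; case: eqP => [->//|_]; by rewrite !mulr0.
Qed.

Lemma size_sorted_eigenvalues A (lam : seq R) : sorted_eigenvalues A lam -> size lam = n.
Proof.
move=> [_ cE]; have := size_char_poly A; rewrite cE.
have -> : \prod_(y <- lam) ('X - (y%:C)%:P) = \prod_(z <- [seq y%:C | y <- lam]) ('X - z%:P).
  by rewrite big_map.
by rewrite size_prod_XsubC size_map => -[].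
Qed.

End UnitaryDiag.

(** * Binary logarithms and the precision required by SGN *)

Section Log2.
Variable R : realType.
Implicit Types x y : R.

(** The inequality [ln (1 + x) <= x] at [x = - 2^-1]. *)
Lemma ln2_ge : 2^-1 <= ln 2 :> R.
Proof.
have := @le_ln1Dx R (- 2^-1); rewrite (_ : 1 + - 2^-1 = 2^-1); last by field.
by rewrite lnV ?posrE // lerN2; apply; rewrite ltrN2 invf_lt1 ?ltr1n.
Qed.

Lemma ln2_gt0 : 0 < ln 2 :> R.
Proof. by apply: lt_le_trans ln2_ge; rewrite invr_gt0. Qed.

Lemma log2M x y : 0 < x -> 0 < y -> log2 (x * y) = log2 x + log2 y.
Proof. by move=> x0 y0; rewrite /log2 lnM ?posrE // mulrDl. Qed.

Lemma log2V x : 0 < x -> log2 x^-1 = - log2 x.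
Proof. by move=> x0; rewrite /log2 lnV ?posrE // mulNr. Qed.

Lemma log2_1 : log2 (1 : R) = 0.
Proof. by rewrite /log2 ln1 mul0r. Qed.

Lemma log2_pow2 k : log2 (2 ^+ k : R) = k%:R.
Proof. by rewrite /log2 lnXn // mulrnAl divff // gt_eqF // ln2_gt0. Qed.

Lemma ler_log2 x y : 0 < x -> x <= y -> log2 x <= log2 y.
Proof.
move=> x0 xy; rewrite /log2 ler_pM2r ?invr_gt0 ?ln2_gt0 //.
by rewrite ler_ln ?posrE // (lt_le_trans x0).
Qed.

Lemma log2_le_nat x k : 0 < x -> x <= 2 ^+ k -> log2 x <= k%:R.
Proof. by move=> x0 xk; rewrite -log2_pow2 ler_log2. Qed.

Lemma log2_ge_nat x k : 2 ^+ k <= x -> k%:R <= log2 x.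
Proof. by move=> kx; rewrite -log2_pow2 ler_log2 // exprn_gt0. Qed.

Lemma log2_ge0 x : 1 <= x -> 0 <= log2 x.
Proof. by move=> x1; rewrite -log2_1 ler_log2. Qed.

Lemma log2_le_double x : 0 < x -> log2 x <= 2 * x.
Proof.
move=> x0; rewrite /log2 ler_pdivrMr ?ln2_gt0 //.
apply: le_trans (ltW (ln_sublinear x0)) _.
have := ln2_ge; nra.
Qed.

Lemma powR2_log2 x : 0 < x -> 2 `^ log2 x = x.
Proof.
move=> x0; rewrite /log2 /powR pnatr_eq0 /= -mulrA mulVf ?gt_eqF ?ln2_gt0 //.
by rewrite mulr1 lnK.
Qed.

Lemma log2_powR x y : log2 (x `^ y) = y * log2 x.
Proof. by rewrite /log2 ln_powR mulrA. Qed.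

Lemma log2_powR2 x : log2 (2 `^ x : R) = x.
Proof. by rewrite log2_powR (log2_pow2 1) mulr1. Qed.

Lemma le_log2_inv x y : 0 < x -> 0 < y -> log2 x <= log2 y -> x <= y.
Proof.
move=> x0 y0 h; rewrite -(powR2_log2 x0) -(powR2_log2 y0).
by rewrite ler_powR // ler1n.
Qed.

(** Write [(1 - x)^-1 = 1 + x / (1 - x)] and apply [ln (1 + y) <= y]; the constant 3 works because
    [3 * ln 2 * (1 - x)] is at least [3 * (1 / 2) * (3 / 4)], which exceeds 1. *)
Lemma log2_1B_ge x : 0 <= x -> x <= 4^-1 -> - (3 * x) <= log2 (1 - x).
Proof.
move=> x0 x4; have p0 : 0 < 1 - x by lra.
rewrite -[_ - _]invrK log2V ?invr_gt0 // lerN2.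
rewrite /log2 ler_pdivrMr ?ln2_gt0 //.
have -> : (1 - x)^-1 = 1 + x / (1 - x) by field; rewrite gt_eqF.
have q0 : 0 <= x / (1 - x) by rewrite divr_ge0 // ltW.
apply: le_trans (le_ln1Dx _) _; first by lra.
rewrite ler_pdivrMr //; have h : 1 <= 3 * ln 2 * (1 - x) by have := ln2_ge; nra.
by rewrite -mulrA -mulrA (mulrCA 3) ler_peMr // mulrA.
Qed.

Lemma lg_ge1 x : 1 <= lg x.
Proof. by rewrite /lg le_max lexx. Qed.

Lemma log2_le_lg x : log2 x <= lg x.
Proof. by rewrite /lg le_max lexx orbT. Qed.

Lemma ler_lg x y : 0 < x -> x <= y -> lg x <= lg y.
Proof.
move=> x0 xy; rewrite [leLHS]/lg ge_max lg_ge1 /=.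
exact: le_trans (ler_log2 x0 xy) (log2_le_lg y).
Qed.

End Log2.

(** * The number of iterations of SGN for the parameter [1 - g / 400] *)

Section SgnIterations.
Variables (R : realType) (g delta eps : R).
Hypotheses (g0 : 0 < g) (g2 : g <= 2) (d0 : 0 < delta) (d12 : delta < 12^-1).
Hypotheses (e1 : g / 64 <= eps) (e2 : eps <= g / 16).
Let L1 := lg g^-1.
Let Ld := log2 (delta * g)^-1.
Let N := sgn_iters (1 - g / 400) delta eps.

Let dg0 : 0 < delta * g. Proof. exact: mulr_gt0. Qed.

Let dg_le : delta * g <= 6^-1.
Proof.
have -> : 6^-1 = 12^-1 * 2 :> R by field.
by apply: ler_pM => //; rewrite ltW.
Qed.

(** [delta * g] is at most [1 / 6]. This keeps the iterated logarithm in the cost nonnegative. *)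
Lemma log2_delta_gap_ge2 : 2 <= Ld.
Proof.
apply: (@log2_ge_nat R _ 2); rewrite -[leLHS]invrK lef_pV2 ?posrE ?invr_gt0 ?exprn_gt0 //.
by apply: le_trans dg_le _; rewrite lef_pV2 ?posrE ?exprn_gt0 // expr2; lra.
Qed.

Let Ld2 := log2_delta_gap_ge2.
Let L11 : 1 <= L1. Proof. exact: lg_ge1. Qed.

(** With [alpha = 1 - g / 400], [x1] is the logarithm of [(1 - alpha)^-1], so the iteration count is
    the ceiling of [x1 + 3 * log2 x1 + log2 x3 + 7.79]. *)
Let x1 := log2 (400 / g).
Let x3 := log2 (delta * eps)^-1.

Let x1_le : x1 <= 10 * L1.
Proof.
rewrite /x1 log2M ?invr_gt0 ?ltr0n //.
have /= h1 := @log2_le_nat R 400 9; have := log2_le_lg g^-1; rewrite -/L1 => h2.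
have : log2 (400 : R) <= 9 by apply: h1; rewrite ?ltr0n // !exprS expr0; lra.
by move: L11; lra.
Qed.

Let x1_ge : 7 <= x1.
Proof.
apply: (@log2_ge_nat R _ 7); rewrite ler_pdivlMr // (_ : 2 ^+ 7 = 128); last by rewrite -natrX.
by move: g2; lra.
Qed.

Let eps0 : 0 < eps. Proof. by apply: lt_le_trans e1; rewrite divr_gt0. Qed.

Let x3_le : x3 <= 7 * Ld.
Proof.
have : x3 <= log2 (2 ^+ 6 * (delta * g)^-1).
  rewrite /x3 ler_log2 ?invr_gt0 ?mulr_gt0 // ler_pdivlMr // mulrC.
  rewrite ler_pdivrMr ?mulr_gt0 // (_ : 2 ^+ 6 = 64); last by rewrite -natrX.
  by rewrite mulrCA ler_pM2l //; move: e1; lra.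
rewrite log2M ?invr_gt0 // log2_pow2 -/Ld; move: Ld2; lra.
Qed.

Let x3_ge : 1 <= x3.
Proof.
apply: (@log2_ge_nat R _ 1); rewrite -[leLHS]invrK lef_pV2 ?posrE ?invr_gt0 ?mulr_gt0 //.
rewrite expr1; move: dg0 dg_le d0 e2 eps0; nra.
Qed.

Let NE : N = (Num.ceil (x1 + 3 * log2 x1 + log2 x3 + 779 / 100))%:~R.
Proof. by rewrite /N /sgn_iters subKr invf_div. Qed.

Let N_ub : N <= x1 + 3 * log2 x1 + log2 x3 + 9.
Proof.
rewrite NE; have := ceilB1_lt (x1 + 3 * log2 x1 + log2 x3 + 779 / 100).
rewrite rmorphB /=; lra.
Qed.

Let N_lb : x1 + 3 * log2 x1 + log2 x3 + 779 / 100 <= N.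
Proof. by rewrite NE ceil_ge. Qed.

Lemma sgn_iters_ge1 : 1 <= N.
Proof.
apply: le_trans N_lb; have := log2_ge0 x3_ge.
have : 0 <= log2 x1 by apply: log2_ge0; move: x1_ge; lra.
by move: x1_ge; lra.
Qed.

(** The bounds [x1 <= 10 L1], [log2 x1 <= 4 + 2 L1] and [log2 x3 <= 3 + log2 Ld] give
    [16 L1 + 24 + log2 Ld], and [L1 >= 1] absorbs the 24. *)
Lemma sgn_iters_le : N <= 40 * L1 + log2 Ld.
Proof.
apply: le_trans N_ub _.
have h1 : log2 x1 <= 4 + 2 * L1.
  apply: (@le_trans _ _ (log2 (10 * L1))).
    by apply: ler_log2 => //; move: x1_ge; lra.
  rewrite log2M ?(lt_le_trans _ L11) //; apply: lerD.
    by apply: (@log2_le_nat R _ 4) => //; rewrite !exprS expr0; lra.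
  by apply: log2_le_double; rewrite (lt_le_trans _ L11).
have h3 : log2 x3 <= 3 + log2 Ld.
  apply: (@le_trans _ _ (log2 (7 * Ld))).
    by apply: ler_log2 => //; move: x3_ge; lra.
  rewrite log2M ?(lt_le_trans _ Ld2) // lerD2r.
  by apply: (@log2_le_nat R _ 3) => //; rewrite !exprS expr0; lra.
move: x1_le L11; lra.
Qed.

(** Exponentiation turns the three logarithmic terms into the factors [400 / g], [x1 ^+ 3] and [x3].
    Only [400 / g] grows faster than logarithmically in [1 / g]. *)
Lemma powR_sgn_iters_le :
  2 `^ (N + 1) <= 400 / g * (10 * L1) ^+ 3 * (7 * Ld) * 2 ^+ 10.
Proof.
have x10 : 0 < x1 by move: x1_ge; lra.
have x30 : 0 < x3 by move: x3_ge; lra.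
have L10 : 0 < L1 by move: L11; lra.
have Ld0 : 0 < Ld by move: Ld2; lra.
have key (a b c : R) : 0 < a -> 0 < b -> 0 < c -> 0 < a * b ^+ 3 * c * 2 ^+ 10 /\
    log2 (a * b ^+ 3 * c * 2 ^+ 10) = log2 a + 3 * log2 b + log2 c + 10.
  move=> a0 b0 c0; split; first by rewrite !mulr_gt0 // exprn_gt0.
  have b3 : 0 < b ^+ 3 by rewrite exprn_gt0.
  rewrite (log2M (mulr_gt0 (mulr_gt0 a0 b3) c0)) ?exprn_gt0 // log2_pow2.
  rewrite (log2M (mulr_gt0 a0 b3) c0) (log2M a0 b3); congr (_ + _ + _ + _).
  by rewrite /log2 lnXn // -[X in X / _ = _]mulr_natl mulrA.
have gg : 0 < 400 / g by rewrite divr_gt0 ?ltr0n.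
apply: (@le_trans _ _ (400 / g * x1 ^+ 3 * x3 * 2 ^+ 10)).
  have [p0 pE] := key _ _ _ gg x10 x30.
  apply: le_log2_inv; rewrite ?powR_gt0 //.
  by rewrite log2_powR2 pE -/x1; move: N_ub; lra.
have x13 : 0 <= x1 ^+ 3 by rewrite exprn_ge0 // ltW.
rewrite ler_pM2r ?exprn_gt0 ?ltr0n //.
apply: (ler_pM (mulr_ge0 (ltW gg) x13) (ltW x30) _ x3_le).
rewrite (ler_pM2l gg) ler_pXn2r // nnegrE ?ltW // mulr_gt0 //.
Qed.

End SgnIterations.

(* The exponent of [alpha] in the precision required by SGN is of order
   [(1 - alpha)^-1], which [log2 alpha ~ - (1 - alpha)] compensates. *)
Lemma sgn_precision (R : realType) (n : nat) (g delta eps c_INV mu c e : R) :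
  (1 < n)%N -> 0 < g -> g <= 2 -> 0 < delta -> delta < 12^-1 ->
  g / 64 <= eps -> eps <= g / 16 ->
  0 <= c_INV <= 8 -> 0 < mu <= c * n%:R `^ e ->
  2 `^ (- ((231 * 10 ^+ 3 * 2 ^+ 10 + 85 + `|log2 c| + `|e|)
           * (log2 n%:R * (lg g^-1 ^+ 3 * log2 (delta * g)^-1)))) <=
  (1 - g / 400) `^ (2 `^ (sgn_iters (1 - g / 400) delta eps + 1)
                    * (c_INV * log2 n%:R + 3))
  / (mu * Num.sqrt n%:R * sgn_iters (1 - g / 400) delta eps).
Proof.
move=> n1 g0 g2 d0 d12 e1 e2 /andP[cI0 cI8] /andP[mu0 muc].
set N := sgn_iters _ _ _; set alpha := 1 - g / 400.
set Y := log2 _ * _.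
have n0 : 0 < n%:R :> R by rewrite ltr0n ltnW.
have N1 : 1 <= N by apply: sgn_iters_ge1.
have N0 : 0 < N by lra.
have a0 : 0 < alpha by rewrite /alpha; lra.
have sn0 : 0 < Num.sqrt n%:R :> R by rewrite sqrtr_gt0.
have c0 : 0 < c.
  by have := lt_le_trans mu0 muc; rewrite pmulr_lgt0 // powR_gt0.
rewrite ler_pdivlMr ?mulr_gt0 //.
(* In logarithms the claim is additive: the terms from [mu], [sqrt n], [N] and the power of [alpha]
   are each bounded by a multiple of [Y]. *)
apply: le_log2_inv; rewrite ?mulr_gt0 ?powR_gt0 //.
rewrite log2M ?mulr_gt0 ?powR_gt0 // log2_powR2 log2_powR !log2M ?mulr_gt0 //.
set Ln := log2 n%:R; set L1 := lg g^-1; set Ld := log2 (delta * g)^-1.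
have Ln1 : 1 <= Ln by apply: (@log2_ge_nat R _ 1); rewrite expr1 ler_nat.
have L11 : 1 <= L1 by exact: lg_ge1.
have Ld2 : 2 <= Ld by exact: log2_delta_gap_ge2.
have L1c : L1 <= L1 ^+ 3 by rewrite exprS ler_peMr ?exprn_ege1 //; lra.
have Ld3 : Ld <= L1 ^+ 3 * Ld by rewrite ler_peMl ?exprn_ege1 //; lra.
have L13 : L1 <= L1 ^+ 3 * Ld by apply: le_trans L1c _; rewrite ler_peMr ?exprn_ge0 //; lra.
have Y3 : L1 ^+ 3 * Ld <= Y by rewrite /Y -/Ln -/L1 -/Ld ler_peMl //; lra.
have Y4 : Ln <= Y by rewrite /Y -/Ln -/L1 -/Ld ler_peMr //; lra.
have hmu : log2 mu <= `|log2 c| * Y + `|e| * Y.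
  apply: le_trans (ler_log2 mu0 muc) _; rewrite log2M ?powR_gt0 // log2_powR -/Ln.
  apply: lerD; first by apply: le_trans (ler_norm _) _; rewrite ler_peMr //; lra.
  apply: le_trans (_ : `|e| * Ln <= _); last by rewrite ler_wpM2l.
  by rewrite ler_wpM2r ?ler_norm //; lra.
have hs : log2 (Num.sqrt n%:R : R) <= Ln.
  have s1 : 1 <= Num.sqrt n%:R :> R by rewrite -[leLHS]sqrtr1 ler_wsqrtr // ler1n ltnW.
  apply: ler_log2 => //; rewrite -[leRHS](sqr_sqrtr (ltW n0)) expr2.
  by rewrite ler_peMr // ltW.
(* From [log2 N <= 2 N], with [N] at most [40 L1 + 2 Ld]. The constant 85 of the statement is this
   84 plus 1 for [sqrt n]. *)
have hN : log2 N <= 84 * Y.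
  apply: le_trans (log2_le_double N0) _.
  have hN1 : N <= 40 * L1 + log2 Ld by exact: sgn_iters_le.
  have hN2 : log2 Ld <= 2 * Ld by apply: log2_le_double; lra.
  lra.
(* The factor [400 / g] in the exponent cancels against [- log2 alpha <= 3 * (g / 400)]; the
   remaining constants multiply to [231 = 7 * 11 * 3], times [10 ^+ 3 * 2 ^+ 10]. *)
have ha : - (2 `^ (N + 1) * (c_INV * Ln + 3) * log2 alpha) <= 231 * 10 ^+ 3 * 2 ^+ 10 * Y.
  have h1 : - log2 alpha <= 3 * (g / 400).
    by rewrite lerNl; apply: log2_1B_ge; lra.
  have h2 : 2 `^ (N + 1) <= 400 / g * (10 * L1) ^+ 3 * (7 * Ld) * 2 ^+ 10.
    exact: powR_sgn_iters_le.
  have h3 : c_INV * Ln + 3 <= 11 * Ln by nra.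
  have p3 : 0 <= c_INV * Ln + 3 by nra.
  rewrite -mulrN.
  apply: (@le_trans _ _ (2 `^ (N + 1) * (c_INV * Ln + 3) * (3 * (g / 400)))).
    by rewrite ler_wpM2l // mulr_ge0 ?powR_ge0.
  apply: (@le_trans _ _ ((400 / g * (10 * L1) ^+ 3 * (7 * Ld) * 2 ^+ 10)
                         * (11 * Ln) * (3 * (g / 400)))).
    apply: ler_wpM2r; first by lra.
    exact: ler_pM (powR_ge0 _ _) p3 h2 h3.
  rewrite /Y -/Ln -/L1 -/Ld le_eqVlt; apply/orP; left; apply/eqP.
  have [b bE] : exists b, b = 2 ^+ 10 :> R by exists (2 ^+ 10).
  by rewrite -bE; field; rewrite gt_eqF.
move: ha; set K0 := 231 * _ * _; move: K0 => K0; lra.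
Qed.

(** * Floating point errors *)

Section FloatingPoint.
Variables (R : realType) (u : R).
Implicit Types (fp : fparith u) (x a b : R).

Lemma fparith_ge0 fp : 0 <= u.
Proof.
have [|d [du _]] := @flP _ _ fp FAdd 0 0; first by [].
exact: le_trans (normr_ge0 d) du.
Qed.

Lemma fl_err fp o a b : (o = FDiv -> b != 0) ->
  `|fp o a b - flop_exact o a b| <= u * `|flop_exact o a b|.
Proof.
move=> /(@flP _ _ fp o a b) [d [du ->]].
by rewrite mulrDl mul1r addrC addKr normrM ler_wpM2r.
Qed.

End FloatingPoint.

Section FloatingPointMatrices.
Variables (R : realType) (u : R) (n : nat) (fp : fparith u).
Implicit Types (A S : 'M[R[i]]_n).

Lemma hermsymmxP A :
  reflect (forall i j, A i j = (A j i)^*%C) (A \is hermsymmx).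
Proof.
apply: (iffP (is_hermitianmxP _ _ _)); rewrite expr0 scale1r => h.
  by move=> i j; rewrite {1}h !mxE.
by apply/matrixP => i j; rewrite h !mxE.
Qed.

Lemma hermsymmx_diag_Im A i : A \is hermsymmx -> complex.Im (A i i) = 0.
Proof.
move=> /hermsymmxP/(_ i i); case: (A i i) => a b [] /= /eqP.
by rewrite -subr_eq0 opprK -mulr2n mulrn_eq0 => /eqP.
Qed.

(** Rounding only affects the diagonal and keeps it real, so the computed shift is exactly Hermitian
    and still has a unitary eigenbasis. *)
Lemma fl_shift_herm mu A : A \is hermsymmx -> fl_shift fp mu A \is hermsymmx.
Proof.
move=> hA; apply/hermsymmxP => i j; rewrite !mxE eq_sym.
case: eqP => [->|_]; last by rewrite rmorphN; congr (- _); exact/hermsymmxP.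
by apply/eqP; rewrite eq_complex /= hermsymmx_diag_Im // !oppr0 !eqxx.
Qed.

Lemma frob2_fl_shift mu A (a : R) : opnorm A <= a ->
  frob2 (mu%:C%:M - A - fl_shift fp mu A) <= (n%:R * (u * (`|mu| + a))) ^+ 2.
Proof.
move=> Aa; have u0 := fparith_ge0 fp.
have a0 (i : 'I_n) : 0 <= a := le_trans (cabs_ge0 _) (le_trans (opnorm_entry A i i) Aa).
have -> : (n%:R * (u * (`|mu| + a))) ^+ 2 = (n * n)%:R * (u * (`|mu| + a)) ^+ 2.
  by rewrite exprMn natrM expr2.
apply: frob2_le => i j; rewrite !mxE; have {}a0 := a0 i.
case: eqP => [<-|_]; last first.
  by rewrite mulr0n sub0r subrr cabs0 mulr_ge0 // addr_ge0.
have Ai : `|complex.Re (A i i)| <= a.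
  exact: le_trans (normr_Re_le _) (le_trans (opnorm_entry A i i) Aa).
set f := fp _ _ _; rewrite mulr1n.
have -> : mu%:C - A i i - (f -i* complex.Im (A i i)) = (mu - complex.Re (A i i) - f)%:C.
  move: f => f; case: (A i i) => x y; apply/eqP.
  by rewrite eq_complex /= sub0r opprK addNr !eqxx.
rewrite cabs_real distrC; apply: le_trans (@fl_err _ _ fp FSub _ _ _) _ => //=.
rewrite ler_wpM2l //; apply: le_trans (ler_normB _ _) _; exact: lerD.
Qed.

Lemma cabs_le_ReIm (z : R[i]) : cabs z <= `|complex.Re z| + `|complex.Im z|.
Proof.
rewrite -(ler_pXn2r (n := 2)) ?nnegrE ?addr_ge0 ?cabs_ge0 //.
rewrite cabs_sqr sqrrD !real_normK ?num_real // -addrA lerD2l lerDr.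
by rewrite mulrn_wge0 // mulr_ge0.
Qed.

Lemma normr_Im_le (z : R[i]) : `|complex.Im z| <= cabs z.
Proof.
rewrite -(ler_pXn2r (n := 2)) ?nnegrE ?cabs_ge0 //.
by rewrite cabs_sqr real_normK ?num_real // lerDr sqr_ge0.
Qed.

Lemma fl_half_err (x : R) : `|fp FMul 2^-1 x - 2^-1 * x| <= u * `|x|.
Proof.
apply: le_trans (@fl_err _ _ fp FMul _ _ _) _ => //=; rewrite ler_wpM2l ?(fparith_ge0 fp) //.
by rewrite normrM ler_piMl // ger0_norm ?invr_ge0 // invf_le1 // ler1n.
Qed.

(** Each entry is off by at most [6 u + 3 u / 2] in its real part and [2 u] in its imaginary part,
    hence by less than [10 u]; the Frobenius norm of [n ^ 2] such entries costs the factor [n]. *)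
Lemma opnorm_fl_half_addI S : u <= 1 -> opnorm S <= 2 ->
  opnorm (fl_half_addI fp S - 2^-1 *: (1%:M + S)) <= n%:R * (10 * u).
Proof.
move=> u1 S2; have u0 := fparith_ge0 fp.
apply: opnorm_le_frob; first by rewrite !mulr_ge0.
have -> : (n%:R * (10 * u)) ^+ 2 = (n * n)%:R * (10 * u) ^+ 2.
  by rewrite exprMn natrM expr2.
apply: frob2_le => i j.
have sR := le_trans (normr_Re_le (S i j)) (le_trans (opnorm_entry S i j) S2).
have sI := le_trans (normr_Im_le (S i j)) (le_trans (opnorm_entry S i j) S2).
rewrite !mxE; set x := if _ then _ else _.
have xe : `|x - ((i == j)%:R + complex.Re (S i j))| <= u * 3.
  rewrite /x; case: eqP => _ /=; last by rewrite add0r subrr normr0 mulr_ge0.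
  apply: le_trans (@fl_err _ _ fp FAdd _ _ _) _ => //=; rewrite ler_wpM2l //.
  by apply: le_trans (ler_normD _ _) _; rewrite normr1; lra.
have x6 : `|x| <= 6.
  rewrite -[x](subrK ((i == j)%:R + complex.Re (S i j))).
  apply: le_trans (ler_normD _ _) _.
  have : `|(i == j)%:R + complex.Re (S i j)| <= 3.
    apply: le_trans (ler_normD _ _) _.
    have : `|(i == j)%:R| <= 1 :> R by case: eqP; rewrite ?normr1 ?normr0.
    by lra.
  by nra.
have he := fl_half_err x; have hi := fl_half_err (complex.Im (S i j)).
set z := (X in cabs X).
have zE : z = (fp FMul 2^-1 x - 2^-1 * ((i == j)%:R + complex.Re (S i j)))
            +i* (fp FMul 2^-1 (complex.Im (S i j)) - 2^-1 * complex.Im (S i j)).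
  rewrite /z; move: (fp _ _ _) (fp _ _ _) => p q.
  have -> : 2^-1 = (2^-1)%:C :> R[i] by rewrite fmorphV rmorph_nat.
  have -> : (i == j)%:R = ((i == j)%:R : R)%:C :> R[i] by rewrite rmorph_nat.
  case: (S i j) => a b; move: ((i == j)%:R : R) => b0; apply/eqP; rewrite eq_complex.
  by apply/andP; split; apply/eqP => /=; ring.
apply: le_trans (cabs_le_ReIm z) _; rewrite zE /=.
have h1 : `|fp FMul 2^-1 x - 2^-1 * ((i == j)%:R + complex.Re (S i j))| <= u * 6 + u * 3 / 2.
  rewrite (_ : _ - _ = (fp FMul 2^-1 x - 2^-1 * x)
     + 2^-1 * (x - ((i == j)%:R + complex.Re (S i j)))); last by ring.
  apply: le_trans (ler_normD _ _) _; apply: lerD.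
    by apply: le_trans he _; rewrite ler_wpM2l.
  by rewrite normrM ger0_norm ?invr_ge0 // mulrC ler_wpM2r ?invr_ge0.
have h2 : u * `|complex.Im (S i j)| <= u * 2 by rewrite ler_wpM2l.
by lra.
Qed.

End FloatingPointMatrices.

(** * The spectrum of the shifted matrix and the circles of Apollonius *)

Lemma apollonius_near_real (R : realType) (g l e : R) (z : R[i]) :
  0 < g -> g <= 2 -> e <= g / 16 -> 2 / 5 * g <= `|l| -> `|l| <= 11 / 5 ->
  cabs (z - l%:C) < e -> apollonius (1 - g / 400) z.
Proof.
move=> g0 g2 eg l1 l2; case: z => x y ze.
have hx : `|x - l| < e.
  by apply: le_lt_trans ze; have /= := normr_Re_le ((x +i* y) - l%:C).
have hy : `|y| < e.
  by apply: le_lt_trans ze; have /= := normr_Im_le ((x +i* y) - l%:C); rewrite subr0.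
have y1 : y ^+ 2 <= 1.
  by rewrite -[_ ^+ 2]real_normK ?num_real // exprn_ile1 //; lra.
have sq (a b : R) : a ^+ 2 + b ^+ 2 = cabs (a +i* b) ^+ 2 by rewrite cabs_sqr.
pose al := 1 - g / 400.
have al0 : 0 < al by rewrite /al; lra.
(* The inequality [|1 - z| <= al |1 + z|], squared: the gain is at least [2 * w >= 3 * g / 5], the
   loss at most [g / 200 * 10]. The left half-plane is treated by applying this to [- x]. *)
have main (w : R) : 3 / 10 * g <= w -> w <= 5 / 2 ->
    (1 - w) ^+ 2 + y ^+ 2 <= al ^+ 2 * ((1 + w) ^+ 2 + y ^+ 2).
  move=> w1 w2; rewrite -subr_ge0.
  have -> : al ^+ 2 * ((1 + w) ^+ 2 + y ^+ 2) - ((1 - w) ^+ 2 + y ^+ 2)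
    = 2 * w * (1 + al ^+ 2) - (1 - al ^+ 2) * (1 + w ^+ 2 + y ^+ 2) by ring.
  have h1 : 1 - al ^+ 2 <= g / 200 by rewrite /al; nra.
  have h2 : 0 <= 1 - al ^+ 2 by rewrite /al; nra.
  have h3 : 1 + w ^+ 2 + y ^+ 2 <= 10 by nra.
  have h4 : (1 - al ^+ 2) * (1 + w ^+ 2 + y ^+ 2) <= g / 200 * 10.
    by apply: ler_pM => //; rewrite !addr_ge0 ?sqr_ge0.
  have h5 : 2 * w <= 2 * w * (1 + al ^+ 2).
    by rewrite ler_peMr ?lerDl ?sqr_ge0 //; lra.
  lra.
have cle (a b c e' : R) : a ^+ 2 + b ^+ 2 <= al ^+ 2 * (c ^+ 2 + e' ^+ 2) ->
    cabs (a +i* b) <= al * cabs (c +i* e').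
  rewrite !sq -exprMn ler_pXn2r // ?nnegrE ?cabs_ge0 // mulr_ge0 ?cabs_ge0 //.
  exact: ltW.
have [lp|ln|l0] := ltgtP 0 l; last by move: l1; rewrite -l0 normr0; lra.
- left; rewrite (gtr0_norm lp) in l1 l2.
  have x1 : 3 / 10 * g <= x by move: hx; rewrite ltr_norml => /andP[]; lra.
  have x2 : x <= 5 / 2 by move: hx; rewrite ltr_norml => /andP[]; lra.
  split; first by rewrite eq_complex /= negb_and; apply/orP; left; rewrite gt_eqF //; lra.
  have n0 : 1 + (x +i* y) != 0.
    by rewrite eq_complex /= negb_and; apply/orP; left; rewrite gt_eqF //; lra.
  rewrite cabsM cabsV ler_pdivrMr; last by rewrite lt_def cabs_eq0 n0 cabs_ge0.
  have -> : 1 - (x +i* y) = (1 - x) +i* (- y) by apply/eqP; rewrite eq_complex /= sub0r !eqxx.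
  have -> : 1 + (x +i* y) = (1 + x) +i* y by apply/eqP; rewrite eq_complex /= add0r !eqxx.
  by apply: cle; rewrite sqrrN; exact: main.
- right; rewrite (ltr0_norm ln) in l1 l2.
  have x1 : 3 / 10 * g <= - x by move: hx; rewrite ltr_norml => /andP[]; lra.
  have x2 : - x <= 5 / 2 by move: hx; rewrite ltr_norml => /andP[]; lra.
  split; first by rewrite eq_complex /= negb_and; apply/orP; left; rewrite lt_eqF //; lra.
  have n0 : 1 - (x +i* y) != 0.
    by rewrite eq_complex /= negb_and; apply/orP; left; rewrite gt_eqF //; lra.
  rewrite cabsM cabsV invf_div ler_pdivrMr; last by rewrite lt_def cabs_eq0 n0 cabs_ge0.
  have -> : 1 - (x +i* y) = (1 - x) +i* (- y) by apply/eqP; rewrite eq_complex /= sub0r !eqxx.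
  have -> : 1 + (x +i* y) = (1 + x) +i* y by apply/eqP; rewrite eq_complex /= add0r !eqxx.
  by apply: cle; rewrite sqrrN; have := main (- x) x1 x2; rewrite opprK.
Qed.

(** Replacing [muk] by [mu] costs [g / 25] of the separation [g / 2] and changes no sign. Rounding
    then moves the matrix by at most [21 / 10 * n * u] in Frobenius norm, since [|mu| + 1] is below
    [21 / 10], so the eigenvalues stay [2 g / 5] away from 0 and the Lipschitz bound for the sign
    applies. *)
Lemma shifted_spectrum (R : realType) (u : R) (fp : fparith u) n (U : 'M[R[i]]_n)
    (l : 'I_n -> R) (g muk mu : R) :
  U \is unitarymx -> unitary_diag U l \is hermsymmx -> opnorm (unitary_diag U l) <= 1 ->
  0 < g -> g <= 2 -> `|muk| <= 1 -> (forall i, g / 2 <= `|muk - l i|) ->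
  `|mu - muk| <= g / 25 -> n%:R * u <= g / 1000 ->
  exists (V : 'M[R[i]]_n) (m : 'I_n -> R),
    [/\ V \is unitarymx, fl_shift fp mu (unitary_diag U l) = unitary_diag V m,
        forall i, 2 / 5 * g <= `|m i| /\ `|m i| <= 11 / 5
      & opnorm (unitary_diag V (fun i => Num.sg (m i))
                - unitary_diag U (fun i => Num.sg (muk - l i)))
        <= 10 * (n%:R * u) / g].
Proof.
move=> Uu hA A1 g0 g2 muk1 lsep mumu nu; have u0 := fparith_ge0 fp.
have nu0 : 0 <= n%:R * u by rewrite mulr_ge0.
have [V [m [Vu mE]]] := hermitian_unitary_diag (fl_shift_herm fp mu hA).
exists V, m.
have mu2 : `|mu| <= 27 / 25.
  by rewrite -[mu](subrK muk); apply: le_trans (ler_normD _ _) _; lra.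
have fE : frob2 (unitary_diag U (fun i => mu - l i) - unitary_diag V m)
    <= (21 / 10 * (n%:R * u)) ^+ 2.
  rewrite -(shift_unitary_diag _ _ Uu) -mE; apply: le_trans (frob2_fl_shift fp mu A1) _.
  rewrite ler_pXn2r ?nnegrE ?mulr_ge0 ?addr_ge0 // mulrA [leRHS]mulrC ler_wpM2l //.
  by lra.
have lsep' i : 23 / 50 * g <= `|mu - l i|.
  have := lsep i; rewrite (_ : muk - l i = (mu - l i) - (mu - muk)); last by ring.
  by have := ler_normB (mu - l i) (mu - muk); lra.
have sgE i : Num.sg (mu - l i) = Num.sg (muk - l i).
  have := lsep i; have := mumu; rewrite ler_norml => /andP[? ?].
  rewrite ler_normr => /orP[] ?.
    by rewrite !gtr0_sg //; lra.
  by rewrite !ltr0_sg //; lra.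
have mb i : 2 / 5 * g <= `|m i| /\ `|m i| <= 11 / 5.
  have [j hj] := unitary_diag_near (fun i => mu - l i) m i Uu Vu.
  have {}hj : `|mu - l j - m i| <= 21 / 10 * (n%:R * u).
    rewrite -(ler_pXn2r (n := 2)) ?nnegrE ?mulr_ge0 ?divr_ge0 //.
    by rewrite real_normK ?num_real // (le_trans hj fE).
  have lj := le_trans (unitary_diag_eig_le l Uu j) A1.
  have h1 := ler_normB (mu - l j) (mu - l j - m i).
  have h3 := ler_normB mu (l j).
  have h4 := ler_normD (mu - l j - m i) (m i).
  have := lsep' j; rewrite subKr in h1; rewrite subrK in h4.
  by split; lra.
split=> //.
apply: opnorm_le_frob; first by rewrite divr_ge0 ?mulr_ge0 // ltW.
have -> : unitary_diag U (fun i => Num.sg (muk - l i)) =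
          unitary_diag U (fun i => Num.sg (mu - l i)).
  by congr unitary_diag; apply/funext => i; rewrite sgE.
have g5 : 0 < 2 / 5 * g by lra.
have fs : (2 / 5 * g) ^+ 2 * frob2 (unitary_diag U (fun i => Num.sg (mu - l i)) -
            unitary_diag V (fun i => Num.sg (m i))) <= (21 / 10 * (n%:R * u)) ^+ 2.
  apply: le_trans fE; apply: (frob2_sgB Uu Vu g5) => i; last by case: (mb i).
  by have := lsep' i; lra.
have -> : frob2 (unitary_diag V (fun i => Num.sg (m i))
                 - unitary_diag U (fun i => Num.sg (mu - l i)))
  = frob2 (unitary_diag U (fun i => Num.sg (mu - l i)) - unitary_diag V (fun i => Num.sg (m i))).
  by rewrite -opprB /frob2; apply: eq_bigr => i _; apply: eq_bigr => j _; rewrite mxE cabsN.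
rewrite -(ler_pM2l (exprn_gt0 2 g5)); apply: le_trans fs _.
rewrite -exprMn (_ : 2 / 5 * g * (10 * (n%:R * u) / g) = 4 * (n%:R * u)).
  by rewrite ler_pXn2r // ?nnegrE; lra.
by field; rewrite gt_eqF.
Qed.

(** * The FERMI loop *)

Lemma fl_relerr (R : realType) (u : R) (fs : fparith u) (o : flop) (a b : R) :
  u <= 100^-1 -> (o = FDiv -> b != 0) ->
  exists e : R, [/\ `|e| <= u, - 100^-1 <= e, e <= 100^-1
                  & fs o a b = (1 + e) * flop_exact o a b].
Proof.
move=> u_small /(@flP _ _ fs o a b)[e [eu ->]]; exists e.
by have := le_trans eu u_small; rewrite ler_norml => /andP[].
Qed.

Lemma ler_pM_itv (F : realDomainType) (a b c d x y : F) : 0 <= a -> 0 <= c ->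
  a <= x <= b -> c <= y <= d -> a * c <= x * y <= b * d.
Proof.
move=> a0 c0 /andP[ax xb] /andP[cy yd]; apply/andP; split; apply: ler_pM => //.
  exact: le_trans ax.
exact: le_trans cy.
Qed.

Section FermiAccuracy.
Variables (R : realType) (u : R) (fs : fparith u) (k : nat) (lam l : seq R) (d : R).
Let g := lam`_k - lam`_k.-1.
Let gt := fermi_gap fs k l.

(** For [eps = 1 / 32] the exact factor [eps / (1 + 2 * eps)] is [1 / 34]; four roundings of at most
    one percent keep it between [1 / 36] and [1 / 32]. *)
Lemma fermi_tol_bounds : u <= 100^-1 ->
  gt / 36 <= fermi_tol fs 32^-1 k l <= gt / 32.
Proof.
move=> u_small; rewrite /fermi_tol -/gt.
have gt0 : 0 <= gt by exact: normr_ge0.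
have [//|e1 [_ e1l e1u ->]] := @fl_relerr _ _ fs FMul 2 32^-1 u_small.
have [//|e2 [_ e2l e2u ->]] :=
  @fl_relerr _ _ fs FAdd 1 ((1 + e1) * flop_exact FMul 2 32^-1) u_small.
set t := (1 + e2) * _; have /andP[t1 t2] : 21 / 20 <= t <= 27 / 25.
  have h : 99 / 100 * (1061 / 1000) <= t <= 101 / 100 * (532 / 500).
    by apply: ler_pM_itv => /=; lra.
  by lra.
have [|e3 [_ e3l e3u ->]] := @fl_relerr _ _ fs FDiv 32^-1 t u_small.
  by move=> _; rewrite gt_eqF //; lra.
have [s sE] : exists s, s = (1 + e3) * (32^-1 / t) by exists ((1 + e3) * (32^-1 / t)).
rewrite /= -sE.
have sB : 57 / 2000 <= s <= 61 / 2000.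
  rewrite sE mulrA ler_pdivlMr ?ler_pdivrMr; by lra.
have [//|e4 [_ e4l e4u ->]] := @fl_relerr _ _ fs FMul s gt u_small.
have /andP[q1 q2] : 99 / 100 * (57 / 2000) <= (1 + e4) * s <= 101 / 100 * (61 / 2000).
  by apply: ler_pM_itv; lra.
rewrite /= mulrA !(mulrC gt); apply/andP; split; apply: ler_wpM2r => //.
  by apply: le_trans q1; lra.
by apply: le_trans q2 _; lra.
Qed.

Lemma fermi_gap_bounds : u <= 100^-1 -> 0 < d ->
  `|l`_k - lam`_k| <= d -> `|l`_k.-1 - lam`_k.-1| <= d ->
  99 / 100 * (g - 2 * d) <= gt /\ (0 < g -> gt <= 101 / 100 * (g + 2 * d)).
Proof.
move=> u_small d0 lk lk1; rewrite ler_norml in lk; rewrite ler_norml in lk1.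
case/andP: lk lk1 => [a1 a2] /andP[b1 b2].
have [//|e [_ el eu E]] := @fl_relerr _ _ fs FSub l`_k.-1 l`_k u_small.
rewrite /gt /fermi_gap E /= normrM (gtr0_norm (_ : 0 < 1 + e)); last by lra.
have h1 : g - 2 * d <= `|l`_k.-1 - l`_k| by rewrite ler_normr /g; apply/orP; right; lra.
have h2 : 0 < g -> `|l`_k.-1 - l`_k| <= g + 2 * d.
  by rewrite ler_norml /g => ?; apply/andP; split; lra.
have h0 := normr_ge0 (l`_k.-1 - l`_k).
have h3 : 99 / 100 * `|l`_k.-1 - l`_k| <= (1 + e) * `|l`_k.-1 - l`_k|.
  by rewrite ler_wpM2r //; lra.
have h4 : (1 + e) * `|l`_k.-1 - l`_k| <= 101 / 100 * `|l`_k.-1 - l`_k|.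
  by rewrite ler_wpM2r //; lra.
by split=> [|/h2 ?]; lra.
Qed.

(** If [d <= g / 40], the measured gap is at least [99 / 100 * (19 / 20) * g], and a 36th of it
    exceeds [g / 40]. *)
Lemma fermi_stops : u <= 100^-1 -> 0 < d ->
  `|l`_k - lam`_k| <= d -> `|l`_k.-1 - lam`_k.-1| <= d ->
  d <= g / 40 -> d <= fermi_tol fs 32^-1 k l.
Proof.
move=> u_small d0 lk lk1 dg; case/andP: (fermi_tol_bounds u_small) => + _.
by apply: le_trans; case: (fermi_gap_bounds u_small d0 lk lk1) => h _; lra.
Qed.

Lemma fermi_output_bounds : u <= 100^-1 -> u <= g / 1000 -> 0 < d -> 0 < g ->
  `|lam`_k| <= 1 -> `|lam`_k.-1| <= 1 ->
  `|l`_k - lam`_k| <= d -> `|l`_k.-1 - lam`_k.-1| <= d ->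
  d <= fermi_tol fs 32^-1 k l ->
  `|fermi_mid fs k l - (lam`_k.-1 + lam`_k) / 2| <= g / 25 /\
  g / 64 <= fs FDiv gt 32 <= g / 16.
Proof.
move=> u_small ug d0 g0 lam1 lam2 lk lk1 stop.
have [h1 /(_ g0) h2] := fermi_gap_bounds u_small d0 lk lk1.
have /andP[_ /(le_trans stop) h3] := fermi_tol_bounds u_small.
(* Stopping gives [32 * d <= gt], and [gt] is itself at most [101 / 100 * (g + 2 * d)]; solving for
   [d] bounds it by the true gap. *)
have dg : d <= g / 29 by lra.
have g2 : g <= 2.
  by move: lam1 lam2; rewrite /g !ler_norml => /andP[? ?] /andP[? ?]; lra.
split.
  rewrite /fermi_mid.
  have [//|e1 [e1a e1l e1u ->]] := @fl_relerr _ _ fs FAdd l`_k.-1 l`_k u_small.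
  have [|e2 [e2a e2l e2u ->]] :=
    @fl_relerr _ _ fs FDiv ((1 + e1) * flop_exact FAdd l`_k.-1 l`_k) 2 u_small.
    by move=> _; rewrite pnatr_eq0.
  rewrite /=; set m := l`_k.-1 + l`_k; pose h := g / 1000.
  have mB : `|m - (lam`_k.-1 + lam`_k)| <= 2 * d.
    rewrite /m (_ : _ - _ = (l`_k.-1 - lam`_k.-1) + (l`_k - lam`_k)); last by ring.
    by apply: le_trans (ler_normD _ _) _; lra.
  have mB' : `|m| <= 12 / 5.
    rewrite -[m](subrK (lam`_k.-1 + lam`_k)); apply: le_trans (ler_normD _ _) _.
    by have := ler_normD lam`_k.-1 lam`_k; lra.
  (* [q] is the combined relative error of the addition and the division. It multiplies a midpoint
     of order 1, not of order [g], which is why [u <= g / 1000] is required. *)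
  set q := e1 + e2 + e2 * e1.
  have qB : `|q| <= 21 / 10 * h.
    have eB : `|e2 * e1| <= u * 100^-1.
      by rewrite normrM ler_pM // ler_norml e1l.
    have h4 := ler_normD (e1 + e2) (e2 * e1); have h5 := ler_normD e1 e2.
    by rewrite -/q in h4; rewrite /h; lra.
  have -> : (1 + e2) * ((1 + e1) * m / 2) - (lam`_k.-1 + lam`_k) / 2
    = (q * m + (m - (lam`_k.-1 + lam`_k))) / 2 by rewrite /q; field.
  have pB : `|q * m| <= 21 / 10 * h * (12 / 5) by rewrite normrM ler_pM.
  rewrite normrM (ger0_norm (_ : 0 <= 2^-1)) ?invr_ge0 // ler_pdivrMr //.
  by apply: le_trans (ler_normD _ _) _; rewrite /h in pB; lra.
have [|e [_ el eu ->]] := @fl_relerr _ _ fs FDiv gt 32 u_small.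
  by move=> _; rewrite pnatr_eq0.
have /andP[q1 q2] : 99 / 100 * (9 / 10 * g / 32) <= (1 + e) * (gt / 32)
                    <= 101 / 100 * (11 / 10 * g / 32).
  by apply: ler_pM_itv; lra.
by rewrite /=; apply/andP; split; lra.
Qed.

End FermiAccuracy.

Section FermiLoop.
Variables (R : realType) (u : R) (fs : fparith u).
Variables (eig : nat -> R -> seq R * nat) (eps : R) (k : nat).

(** The tolerances come from rounded halvings alone, whatever [eig] returns; they are thus known
    before any random choice. *)
Definition fermi_delta (t : nat) : R := iter t (fun d => fs FDiv d 2) 2^-1.

Lemma fermi_delta_gt0 t : u <= 100^-1 -> 0 < fermi_delta t.
Proof.
move=> u_small; elim: t => [|t IH] /=; first by rewrite invr_gt0.
have [|e [_ el eu ->]] := @fl_relerr _ _ fs FDiv (fermi_delta t) 2 u_small.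
  by move=> _; rewrite pnatr_eq0.
by rewrite /= mulr_gt0 ?divr_gt0 //; lra.
Qed.

Lemma fermi_deltaS_bounds t : u <= 100^-1 ->
  fermi_delta t / 4 <= fermi_delta t.+1 <= fermi_delta t * (2 / 3).
Proof.
move=> u_small; have d0 := fermi_delta_gt0 t u_small.
have [|e [_ el eu /= ->]] := @fl_relerr _ _ fs FDiv (fermi_delta t) 2 u_small.
  by move=> _; rewrite pnatr_eq0.
rewrite mulrCA -/(fermi_delta t).
by apply/andP; split; apply: ler_wpM2l; (exact: ltW || lra).
Qed.

Lemma fermi_delta_ge t : u <= 100^-1 -> 4^-1 ^+ t.+1 <= fermi_delta t.
Proof.
move=> u_small; elim: t => [|t IH].
  by rewrite expr1 /fermi_delta /= lef_pV2 ?posrE // ler_nat.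
have /andP[+ _] := fermi_deltaS_bounds t u_small; apply: le_trans.
by rewrite exprSr ler_pM2r.
Qed.

(** A rounded halving may shrink by [2 / 3] only, but two of them shrink by [4 / 9], better than one
    exact halving. *)
Lemma fermi_delta_le t : u <= 100^-1 -> fermi_delta (t + t) <= 2^-1 ^+ t.+1.
Proof.
move=> u_small; elim: t => [|t IH]; first by rewrite expr1.
have /andP[_ h1] := fermi_deltaS_bounds (t + t) u_small.
have /andP[_ h2] := fermi_deltaS_bounds (t + t).+1 u_small.
have d0 := fermi_delta_gt0 (t + t) u_small.
rewrite addSn addnS exprS; lra.
Qed.

Lemma fermi_delta_lt1 t : u <= 100^-1 -> fermi_delta t < 1.
Proof.
move=> u_small; elim: t => [|t IH]; first by rewrite /fermi_delta /= invf_lt1 ?ltr1n.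
have /andP[_ h1] := fermi_deltaS_bounds t u_small.
by have := fermi_delta_gt0 t u_small; lra.
Qed.

(** Induction on the distance [m] to a round whose test is known to succeed: the loop stops there or
    earlier. Charging 8 operations to every round covers both the last round and the others. *)
Lemma fermi_run_exists (m t : nat) :
  fermi_delta (t + m) <= fermi_tol fs eps k (eig (t + m) (fermi_delta (t + m))).1 ->
  exists (s c : nat), [/\ (t <= s <= t + m)%N,
    fermi_delta s <= fermi_tol fs eps k (eig s (fermi_delta s)).1,
    fermi_run fs eig eps k t (fermi_delta t)
      (fermi_mid fs k (eig s (fermi_delta s)).1,
       fermi_gap fs k (eig s (fermi_delta s)).1, c)
    & (c <= \sum_(t <= r < (t + m).+1) ((eig r (fermi_delta r)).2 + 8))%N].
Proof.
elim: m t => [|m IH] t.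
  rewrite addn0 => stop; exists t, ((eig t (fermi_delta t)).2 + 8)%N.
  rewrite leqnn big_nat1; split=> //; exact: FermiStop.
rewrite addnS -addSn => /IH [s [c [/andP[ts st] stop run cle]]].
have [now|next] := leP (fermi_delta t) (fermi_tol fs eps k (eig t (fermi_delta t)).1).
  exists t, ((eig t (fermi_delta t)).2 + 8)%N; split=> //.
  - by rewrite leqnn addSn ltnW // ltnS leq_addr.
  - exact: FermiStop.
  - by rewrite big_ltn ?leq_addr // addSn ltnS ltnW // ltnS leq_addr.
exists s, ((eig t (fermi_delta t)).2 + 7 + c)%N; split=> //.
- by rewrite st ltnW.
- exact: FermiNext.
- rewrite big_ltn; last by rewrite addSn ltnS ltnW // ltnS leq_addr.
  by rewrite leq_add // leq_add2l.
Qed.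

End FermiLoop.

(** * Union bound *)

Section Probability.
Variables (R : realType) (d : measure_display) (W : measurableType d).
Variable P : probability W R.

(** The measurable witnesses of the events are intersected, and the measures of their complements
    add up. *)
Lemma with_prob_at_least_all (q : R) (E : nat -> set W) (m : nat) :
  (forall t, (t < m)%N -> with_prob_at_least P (1 - q) (E t)) ->
  with_prob_at_least P (1 - m%:R * q) [set w | forall t, (t < m)%N -> E t w].
Proof.
elim: m => [_|m IH h].
  exists setT; split=> //.
  by rewrite mul0r subr0 probability_setT.
have [G1 [mG1 sG1 pG1]] := IH (fun t tm => h t (ltnW tm)).
have [G2 [mG2 sG2 pG2]] := h m (ltnSn m).
exists (G1 `&` G2); split; first exact: measurableI.
  move=> w [w1 w2] t; rewrite ltnS leq_eqVlt => /orP[/eqP ->|tm]; first exact: sG2.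
  exact: sG1.
have mG := measurableI _ _ mG1 mG2.
have : (P (~` (G1 `&` G2)) <= P (~` G1) + P (~` G2))%E.
  by rewrite setCI; apply: measureU2; exact: measurableC.
rewrite (probability_setC P mG) (probability_setC P mG1) (probability_setC P mG2).
move: pG1 pG2; rewrite -(fineK (fin_num_measure P _ mG1)) -(fineK (fin_num_measure P _ mG2)).
rewrite -(fineK (fin_num_measure P _ mG)) -!EFinB -EFinD !lee_fin -natr1; lra.
Qed.

Lemma with_prob_at_least_sub (p q : R) (E F : set W) :
  q <= p -> E `<=` F -> with_prob_at_least P p E -> with_prob_at_least P q F.
Proof.
move=> qp EF [G [mG GE pG]]; exists G; split=> //; first exact: subset_trans EF.
by apply: le_trans pG; rewrite lee_fin.
Qed.

End Probability.

(** * The DENSITY algorithm *)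

(** The factor [2^-1] in the projector halves the error [delta] of SGN; the other half pays for the
    perturbation of the sign, at most [delta / 20], and the final roundings, at most [delta / 5]. *)
Lemma density_accuracy (R : realType) (u : R) (fp : fparith u) n
    (T T' S : 'M[R[i]]_n) (g delta : R) :
  0 < g -> g <= 2 -> delta <= 1 -> u <= 1 ->
  128 * (n%:R * u) <= delta * g ->
  opnorm (T - T') <= delta -> opnorm T' <= 1 -> opnorm (T' - S) <= 10 * (n%:R * u) / g ->
  opnorm (fl_half_addI fp T - 2^-1 *: (1%:M + S)) <= delta.
Proof.
move=> g0 g2 d1 u1 nu.
have nu0 : 0 <= n%:R * u by rewrite mulr_ge0 // (fparith_ge0 fp).
have d0 : 0 <= delta by have := le_trans (mulr_ge0 (ler0n _ 128) nu0) nu; rewrite pmulr_lge0.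
have h4 : 10 * (n%:R * u) / g <= delta / 10.
  by rewrite ler_pdivrMr //; lra.
have h5 : n%:R * (10 * u) <= delta / 5.
  have : delta * g <= delta * 2 by rewrite ler_wpM2l.
  by rewrite mulrCA; lra.
have d2 : delta + 1 <= 2 by lra.
have d3 : delta / 5 + (2^-1 * delta + 2^-1 * (delta / 10)) <= delta by lra.
move=> TT' T'1 T'S.
have T2 : opnorm T <= 2.
  rewrite -[T](subrK T'); apply: le_trans (opnormD _ _) _.
  exact: le_trans (lerD TT' T'1) d2.
have h1 := opnorm_fl_half_addI fp u1 T2.
have c2 : cabs (2^-1 : R[i]) = 2^-1.
  have -> : 2^-1 = (2^-1)%:C :> R[i] by rewrite fmorphV rmorph_nat.
  by rewrite cabs_real ger0_norm // invr_ge0.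
have h2 := opnormZ_le 2^-1 TT'.
have h3 := opnormZ_le 2^-1 (le_trans T'S h4); rewrite c2 in h2 h3.
have -> : fl_half_addI fp T - 2^-1 *: (1%:M + S) =
  (fl_half_addI fp T - 2^-1 *: (1%:M + T)) + (2^-1 *: (T - T') + 2^-1 *: (T' - S)).
  rewrite -scalerDr [T - T' + _]addrA subrK -addrA; congr (_ + _).
  rewrite -!scalerN -scalerDr; congr (_ *: _).
  by rewrite !opprD -addrA (addrA (- T)) addNr add0r.
apply: le_trans (opnormD _ _) _; apply: le_trans d3.
apply: lerD; first exact: le_trans h1 h5.
by apply: le_trans (opnormD _ _) _; exact: lerD.
Qed.

(** No member of a sorted sequence lies strictly between two consecutive ones. *)
Lemma sorted_gap_separation (R : realType) (lam : seq R) k x :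
  sorted <=%O lam -> (0 < k < size lam)%N -> x \in lam ->
  (lam`_k - lam`_k.-1) / 2 <= `|(lam`_k.-1 + lam`_k) / 2 - x|.
Proof.
move=> sl /andP[k0 kn] /(nthP 0)[j jn <-].
have mono := sorted_leq_nth (@le_trans _ R) (@lexx _ R) 0 sl.
have [jk|kj] := ltnP j k.
  have h : lam`_j <= lam`_k.-1.
    by apply: mono; rewrite ?inE //; [exact: leq_ltn_trans (leq_pred k) kn | rewrite -ltnS prednK].
  by rewrite ler_normr; apply/orP; left; lra.
have h : lam`_k <= lam`_j by apply: mono.
by rewrite ler_normr; apply/orP; right; lra.
Qed.

Lemma fermi_rounds (R : realType) (u : R) (fs : fparith u) (g : R) (n : nat) :
  u <= 100^-1 -> 0 < g -> g <= 2 -> (1 < n)%N ->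
  exists m : nat, [/\ fermi_delta fs (m + m) <= g / 40,
    (m + m).+1%:R <= 15 * lg g^-1
    & forall t, (t < (m + m).+1)%N ->
      0 <= log2 (n%:R / fermi_delta fs t) <= 32 * lg (n%:R / g)].
Proof.
move=> us g0 g2 n1.
have n0 : 0 < n%:R :> R by rewrite ltr0n ltnW.
pose x := log2 (40 / g).
have x0 : 0 <= x by apply: log2_ge0; rewrite ler_pdivlMr //; lra.
have L11 := lg_ge1 g^-1.
have x7 : x <= 7 * lg g^-1.
  rewrite /x log2M ?invr_gt0 //.
  have : log2 (40 : R) <= 6 by apply: (@log2_le_nat R _ 6) => //; rewrite !exprS expr0; lra.
  by have := log2_le_lg g^-1; lra.
have /andP[mx xm] := truncn_itv x0.
(* [m] is the integer part of [log2 (40 / g)], so [2 ^+ m.+1] exceeds [40 / g]. Doubling [m]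
   compensates for the rounded halvings. *)
exists (Num.truncn x); set m := Num.truncn x in mx xm *.
have T15 : (m + m).+1%:R <= 15 * lg g^-1 by rewrite -natr1 natrD; lra.
split=> // [|t tm].
  apply: le_trans (fermi_delta_le fs m us) _.
  rewrite exprVn -[g / 40]invf_div lef_pV2 ?posrE ?exprn_gt0 ?divr_gt0 //.
  by apply: le_log2_inv; rewrite ?divr_gt0 ?exprn_gt0 // log2_pow2 ltW.
have d0 := fermi_delta_gt0 fs t us; have d1 := fermi_delta_lt1 fs t us.
have n1' : 1 <= n%:R :> R by rewrite ler1n ltnW.
apply/andP; split.
  by apply: log2_ge0; rewrite ler_pdivlMr // mul1r; apply: le_trans n1'; exact: ltW.
rewrite log2M ?invr_gt0 //.
have h1 : log2 n%:R <= 2 * lg (n%:R / g).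
  have nE : n%:R = n%:R / g * g by rewrite divfK // gt_eqF.
  rewrite {1}nE log2M ?divr_gt0 //.
  have : log2 g <= 1 by apply: (@log2_le_nat R _ 1) => //; rewrite expr1.
  have := log2_le_lg (n%:R / g); have := lg_ge1 (n%:R / g); lra.
(* Here [fermi_delta t] is at least [4^-1 ^+ t.+1] and [t.+1] is at most [15 * lg g^-1]; with the 2
   from [log2 n] this makes 32. *)
have h2 : log2 (fermi_delta fs t)^-1 <= 30 * lg g^-1.
  apply: (@le_trans _ _ (log2 (2 ^+ (2 * t.+1)))).
    apply: ler_log2; first by rewrite invr_gt0.
    rewrite -[leRHS]invrK lef_pV2 ?posrE ?invr_gt0 ?exprn_gt0 //.
    by have := fermi_delta_ge fs t us; rewrite exprM -natrX exprVn.
  rewrite log2_pow2 natrM; have : t.+1%:R <= (m + m).+1%:R :> R by rewrite ler_nat.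
  by lra.
have h3 : lg g^-1 <= lg (n%:R / g).
  by apply: ler_lg; rewrite ?invr_gt0 // ler_peMl // invr_ge0 ltW.
by lra.
Qed.

Lemma precision_bounds (R : realType) (n : nat) (g delta u C : R) :
  (1 < n)%N -> 0 < g -> g <= 2 -> 0 < delta -> delta < 12^-1 -> 40 <= C ->
  let X := log2 n%:R * (lg g^-1 ^+ 3 * log2 (delta * g)^-1 + lg (n%:R / g) ^+ 4) in
  0 <= u -> u <= 2 `^ (- (C * X)) ->
  [/\ log2 n%:R * (lg g^-1 ^+ 3 * log2 (delta * g)^-1) <= X,
      lg (n%:R / g) ^+ 4 * log2 n%:R <= X, 0 <= X
    & 128 * (n%:R * u) <= delta * g].
Proof.
move=> n1 g0 g2 d0 d12 C40 X u0 uX.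
have n0 : 0 < n%:R :> R by rewrite ltr0n ltnW.
have dg0 : 0 < delta * g by rewrite mulr_gt0.
pose Ln : R := log2 n%:R; pose L3 := lg g^-1 ^+ 3; pose Ld := log2 (delta * g)^-1.
pose L4 := lg (n%:R / g) ^+ 4.
have Ln1 : 1 <= Ln by apply: (@log2_ge_nat R _ 1); rewrite expr1 ler_nat.
have Ld2 : 2 <= Ld by exact: log2_delta_gap_ge2.
have L31 : 1 <= L3 by rewrite exprn_ege1 ?lg_ge1.
have L41 : 1 <= L4 by rewrite exprn_ege1 ?lg_ge1.
have XE : X = Ln * (L3 * Ld) + Ln * L4 by rewrite /X mulrDr.
have p1 : Ld <= L3 * Ld by rewrite ler_peMl //; lra.
have p2 : L3 * Ld <= Ln * (L3 * Ld) by rewrite ler_peMl //; lra.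
have p3 : Ln <= Ln * L4 by rewrite ler_peMr //; lra.
split.
- by rewrite XE -/Ln -/L3 -/Ld; lra.
- by rewrite mulrC XE -/Ln -/L4; lra.
- by rewrite XE; lra.
(* Exact arithmetic is set apart because the comparison below takes the logarithm of [u]. *)
have [-> |un0] := eqVneq u 0; first by rewrite !mulr0 ltW.
have up : 0 < u by rewrite lt_def un0.
have nu0 : 0 < n%:R * u by rewrite mulr_gt0.
have p128 : 0 < 128 :> R by rewrite ltr0n.
apply: (le_log2_inv (mulr_gt0 p128 nu0) dg0).
have := ler_log2 up uX; rewrite log2_powR2 => hu.
have k10 : log2 (128 : R) = 7 by rewrite -(@log2_pow2 R 7) -natrX.
rewrite (log2M p128 nu0) (log2M n0 up) k10 -/Ln.
have LdE : log2 (delta * g) = - Ld by rewrite /Ld log2V // opprK.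
have X3 : 3 <= X by rewrite XE; lra.
have : 40 * X <= C * X by rewrite ler_wpM2r //; lra.
rewrite LdE; lra.
Qed.

(** The lower bound on [T] absorbs the operations outside EIG and SGN: 8 scalar ones in each of
    [15 * L1] rounds give [120 * cm], and [n + 1 + n + 2 * n ^ 2 <= 5 * n ^ 2] gives the other
    [5 * cm]. *)
Lemma density_cost_bound (R : realType) (n c s : nat)
    (T cE cm cS L1 Lng LLd N r : R) :
  0 <= cE -> 0 < cm -> 0 <= cS -> (0 < n)%N -> 1 <= L1 -> 1 <= Lng -> 0 <= LLd ->
  n%:R ^+ 2 <= cm * T -> r <= 15 * L1 ->
  c%:R <= r * (cE * (T * (32 * Lng) ^+ 2) + 8) ->
  N <= 40 * L1 + LLd -> s%:R <= cS * (N * T) ->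
  (c + n + 1 + s + (n + 2 * n ^ 2))%N%:R <=
  (15 * 32 ^+ 2 * cE + 125 * cm + 40 * cS) * (T * (Lng ^+ 2 * L1 + LLd)).
Proof.
move=> cE0 cm0 cS0 n0 L11 Lng1 LLd0 nT rL hc hN hs.
have n1 : 1 <= n%:R :> R by rewrite ler1n.
have nn : n%:R <= n%:R ^+ 2 :> R by rewrite expr2 ler_peMl //; lra.
have cT : 1 <= cm * T by apply: le_trans nT; lra.
have T0 : 0 < T by rewrite -(pmulr_rgt0 _ cm0); lra.
have Q1 : 1 <= Lng ^+ 2 by rewrite exprn_ege1.
have LB : L1 <= Lng ^+ 2 * L1 by rewrite ler_peMl //; lra.
set B := Lng ^+ 2 * L1 + LLd.
have B1 : 1 <= B by rewrite /B; lra.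
have BL : Lng ^+ 2 * L1 <= B by rewrite /B; lra.
have hB : B <= cm * T * B by rewrite ler_peMl //; lra.
have h1 : c%:R <= 15 * 32 ^+ 2 * cE * (T * B) + 120 * (cm * T * B).
  apply: le_trans hc _.
  apply: (@le_trans _ _ (15 * L1 * (cE * (T * (32 * Lng) ^+ 2) + 8))).
    apply: ler_wpM2r rL; apply: addr_ge0 => //.
    by do 2!(apply: mulr_ge0 => //); [exact: ltW | exact: sqr_ge0].
  have -> : 15 * L1 * (cE * (T * (32 * Lng) ^+ 2) + 8) =
    15 * 32 ^+ 2 * cE * (T * (Lng ^+ 2 * L1)) + 120 * L1 by ring.
  apply: lerD; last by lra.
  apply: ler_wpM2l; first by do 2!(apply: mulr_ge0 => //).
  by apply: ler_wpM2l => //; exact: ltW.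
have h2 : s%:R <= 40 * cS * (T * B).
  apply: le_trans hs _.
  have -> : 40 * cS * (T * B) = cS * (40 * B * T) by ring.
  apply: ler_wpM2l => //; apply: ler_wpM2r; first exact: ltW.
  by apply: le_trans hN _; rewrite /B; lra.
rewrite (natrD _ _ (n + 2 * n ^ 2)) (natrD _ (c + n + 1)) (natrD _ (c + n)) (natrD _ c).
rewrite (natrD _ n) natrM natrX.
have h3 : n%:R ^+ 2 <= cm * T * B.
  by apply: le_trans nT _; rewrite ler_peMr //; lra.
have -> : (15 * 32 ^+ 2 * cE + 125 * cm + 40 * cS) * (T * B) =
  15 * 32 ^+ 2 * cE * (T * B) + 125 * (cm * T * B) + 40 * cS * (T * B) by ring.
move: h1 h2 h3 nn n1; move: (15 * _ * _ * _) (40 * _ * _) (cm * T * B) => x y z; lra.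
Qed.

Theorem theorem5p4 (R : realType)
    (d : measure_display) (W : measurableType d) (P : probability W R)
    (omega eta : R) (T_MM mu_INV : nat -> R) (c_INV : R)
    (SGN : sgn_alg R) (EIG : eig_alg R W) :
  2 <= omega -> 0 < eta -> mm_cost omega eta T_MM ->
  inv_params mu_INV c_INV ->
  sgn_spec T_MM mu_INV c_INV SGN ->
  eig_spec P T_MM EIG ->
  exists2 C : R, 0 < C &
  forall (n : nat) (A S : 'M[R[i]]_n) (lam : seq R) (k : nat) (delta : R),
  A \is hermsymmx -> opnorm A <= 1 -> sorted_eigenvalues A lam ->
  (0 < k < n)%N ->
  let gap_k := `|lam`_k - lam`_k.-1| in
  let mu_k := (lam`_k.-1 + lam`_k) / 2 in
  0 < gap_k ->
  is_sgn (mu_k%:C%:M - A) S ->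
  let Pk := 2^-1 *: (1%:M + S) in
  0 < delta < 12^-1 ->
  forall (u : R) (fp fs : fparith u),
  bits_at_least u
    (C * (log2 n%:R * (lg gap_k^-1 ^+ 3 * log2 (delta * gap_k)^-1
                       + lg (n%:R / gap_k) ^+ 4))) ->
  with_prob_at_least P (1 - C * (lg gap_k^-1 / n%:R))
    [set w | exists out : 'M[R[i]]_n * nat,
       [/\ density_run fp fs SGN (fun t => EIG u fp t w n A) A delta k out,
           opnorm (out.1 - Pk) <= delta
         & out.2%:R <= C * (T_MM n * (lg (n%:R / gap_k) ^+ 2 * lg gap_k^-1
                                      + log2 (log2 (delta * gap_k)^-1)))]].

Proof.
move=> _ _ [cm cm0 HM] [cIb [cmu [e Hmu]]] [cS cS0 HS] [cE cE0 HE].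
have [K KE] : exists K, K = 231 * 10 ^+ 3 * 2 ^+ 10 + 85 + `|log2 cmu| + `|e|.
  by exists (231 * 10 ^+ 3 * 2 ^+ 10 + 85 + `|log2 cmu| + `|e|).
(* [316 = 231 + 85]; this exceeds [255 = 15 * 17], the constant of the union bound over [15 * L1]
   rounds of failure probability [17 / n]. *)
have K316 : 316 <= K.
  have p : 1 <= 10 ^+ 3 * 2 ^+ 10 :> R by rewrite mulr_ege1 // exprn_ege1 // ler1n.
  have : 231 <= 231 * (10 ^+ 3 * 2 ^+ 10) :> R by rewrite ler_peMr // ler0n.
  rewrite KE mulrA; have := normr_ge0 (log2 cmu); have := normr_ge0 e.
  by move: (231 * _ * _) => K0; lra.
have [c1 c1E] : exists c1, c1 = 32 ^+ 4 * cE by exists (32 ^+ 4 * cE).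
have [c2 c2E] : exists c2, c2 = 15 * 32 ^+ 2 * cE + 125 * cm + 40 * cS.
  by exists (15 * 32 ^+ 2 * cE + 125 * cm + 40 * cS).
have c10 : 0 <= c1 by rewrite c1E mulr_ge0 ?exprn_ge0 ?ler0n // ltW.
have c20 : 0 <= c2.
  by rewrite c2E !addr_ge0 // !mulr_ge0 ?exprn_ge0 ?ler0n // ltW.
have K0 : 0 <= K by clear - K316; lra.
(* [K] governs the precision of SGN, [c1] that of the eigenvalue computations and [c2] the operation
   count. *)
have [C [CK Cc1 Cc2]] : exists C, [/\ K <= C, c1 <= C & c2 <= C].
  by exists (K + c1 + c2); split; [rewrite -addrA lerDl addr_ge0 |
     rewrite addrAC lerDr addr_ge0 | rewrite lerDr addr_ge0].
have C316 : 316 <= C := le_trans K316 CK.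
have C0 : 0 <= C by clear - C316; lra.
exists C; first by clear - C316; lra.
move=> n A S lam k delta hA A1 hlam kkn g muk g0 sgS Pk /andP[d0 d12] u fp fs bits.
have /andP[k0 kn] := kkn.
have n1 : (1 < n)%N by exact: leq_ltn_trans k0 kn.
have n0 : (0 < n)%N := ltnW n1.
have slam := size_sorted_eigenvalues hlam.
have [U [l [Uu AE]]] := hermitian_unitary_diag hA; subst A.
have lamle j : (j < n)%N -> `|lam`_j| <= 1.
  move=> jn; have /(mem_unitary_diag Uu hlam) [i <-] : lam`_j \in lam.
    by rewrite mem_nth // slam.
  exact: le_trans (unitary_diag_eig_le l Uu i) A1.
have k1n : (k.-1 < n)%N := leq_ltn_trans (leq_pred k) kn.
have gE : g = lam`_k - lam`_k.-1.
  rewrite /g ger0_norm // subr_ge0.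
  apply: (sorted_leq_nth (@le_trans _ R) (@lexx _ R) 0 hlam.1); rewrite ?inE ?slam //.
  exact: leq_pred.
have sep i : g / 2 <= `|muk - l i|.
  rewrite gE; apply: sorted_gap_separation; first exact: hlam.1.
    by rewrite slam.
  exact: (unitary_diag_mem Uu hlam).
have SE : S = unitary_diag U (fun i => Num.sg (muk - l i)).
  apply: (is_sgn_unitary_diag_eq Uu); move: sgS.
  by rewrite (shift_unitary_diag _ _ Uu).
have lk := lamle _ kn; have lk1 := lamle _ k1n.
clearbody g.
have g2 : g <= 2.
  by rewrite gE; move: lk lk1; clear; rewrite !ler_norml => /andP[? ?] /andP[? ?]; lra.
have muk1 : `|muk| <= 1.
  rewrite /muk; move: lk lk1; clear; rewrite !ler_norml => /andP[? ?] /andP[? ?].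
  by apply/andP; split; lra.
have u0 := fparith_ge0 fp.
have C40 : 40 <= C by clear - C316; lra.
have [YX ZX X0 nuD] := precision_bounds n1 g0 g2 d0 d12 C40 u0 bits.
have n1' : 1 <= n%:R :> R by rewrite ler1n.
have un : u <= n%:R * u by rewrite ler_peMl.
have dg : delta * g <= 12^-1 * g by rewrite ler_wpM2r // ltW.
have us : u <= 100^-1 by clear - un nuD dg g2; lra.
have ul1 : u <= 1 by clear - us; lra.
have dl1 : delta <= 1 by clear - d12; lra.
have g16 : g / 16 < 1 by clear - g2; lra.
have g400 : 0 < g / 400 < 100^-1 by clear - g0 g2; lra.
have nug : n%:R * u <= g / 1000 by clear - nuD dg g0; lra.
have ug : u <= g / 1000 := le_trans un nug.
have [m [dm mL dL]] := fermi_rounds fs us g0 g2 n1.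
set L1 := lg g^-1 in bits YX X0 ZX mL *; set Lng := lg (n%:R / g) in bits YX X0 ZX dL *.
have L11 : 1 <= L1 by exact: lg_ge1.
have Lng1 : 1 <= Lng by exact: lg_ge1.
have L10 : 0 <= L1 := le_trans ler01 L11.
have Lng0 : 0 <= Lng := le_trans ler01 Lng1.
have Ln0 : 0 <= log2 n%:R :> R by apply: log2_ge0.
have Ld2 : 2 <= log2 (delta * g)^-1 by exact: log2_delta_gap_ge2.
have LLd0 : 0 <= log2 (log2 (delta * g)^-1) by apply: log2_ge0; clear - Ld2; lra.
have T0 : 0 <= T_MM n.
  by rewrite -(pmulr_rge0 _ cm0); apply: le_trans (HM n n0).1; rewrite sqr_ge0.
pose fd := fermi_delta fs.
(* The good event asks all rounds up to [m + m] to succeed at their predetermined tolerances; on it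
   everything that follows is deterministic. *)
apply: with_prob_at_least_sub (with_prob_at_least_all (m := (m + m).+1) (q := 17 / n%:R)
  (E := fun t => [set w | let out := EIG u fp t w n (unitary_diag U l) (fd t) in
       [/\ size out.1 = n, sorted <=%O out.1,
           forall i, (i < n)%N -> `|out.1`_i - lam`_i| <= fd t
         & out.2%:R <= cE * (T_MM n * log2 (n%:R / fd t) ^+ 2)]]) _).
- rewrite lerD2l lerN2 !mulrA ler_wpM2r ?invr_ge0 //.
  have := ler_wpM2r L10 C316; clear - mL L10; lra.
- move=> w /= Hw.
  pose eig t := EIG u fp t w n (unitary_diag U l).
  have dpos t : 0 < fd t by exact: fermi_delta_gt0.
  (* At round [m + m] the tolerance is at most [g / 40], so a successful eigenvalue computation
     forces the loop to stop there at the latest. *)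
  have stopm : fd (0 + (m + m))%N <=
      fermi_tol fs 32^-1 k (eig (0 + (m + m))%N (fd (0 + (m + m))%N)).1.
    have [_ _ err _] := Hw (m + m)%N (ltnSn _).
    apply: (fermi_stops fs us (dpos _) (err _ kn) (err _ k1n)).
    by rewrite -gE.
  have [s [c [/andP[_ sm] stop run cle]]] := fermi_run_exists stopm.
  rewrite add0n in sm cle.
  have [_ _ err _] := Hw s sm.
  have gg0 : 0 < lam`_k - lam`_k.-1 by rewrite -gE.
  have ug' : u <= (lam`_k - lam`_k.-1) / 1000 by rewrite -gE.
  have [midB epsB] := fermi_output_bounds us ug' (dpos s) gg0 lk lk1 (err _ kn) (err _ k1n) stop.
  rewrite -gE -/muk in midB epsB.
  set mu := fermi_mid _ _ _ in midB run; set gap := fermi_gap _ _ _ in epsB run.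
  have [V [mm [Vu fE mB SS]]] := shifted_spectrum fp Uu hA A1 g0 g2 muk1 sep midB nug.
  set eps := fs FDiv gap 32 in epsB.
  have /andP[eps1 eps2] := epsB.
  have eps0 : 0 < eps by apply: lt_le_trans eps1; rewrite divr_gt0 // ltr0n.
  pose S' := unitary_diag V (fun i => Num.sg (mm i)).
  have sgn' : is_sgn (fl_shift fp mu (unitary_diag U l)) S'.
    rewrite fE; apply: (is_sgn_unitary_diag Vu) => i; have [h _] := mB i.
    by rewrite -normr_gt0; apply: lt_le_trans h; rewrite !mulr_gt0 // invr_gt0 ltr0n.
  have psp : pseudospectrum eps (fl_shift fp mu (unitary_diag U l)) `<=` apollonius (1 - g / 400).
    move=> z; rewrite fE => /(pseudospectrum_unitary_diag Vu eps0) [i zi].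
    have [h1 h2] := mB i; exact: (apollonius_near_real g0 g2 eps2 h1 h2 zi).
  have [Tacc Tcost] :
      opnorm ((SGN u fp n (fl_shift fp mu (unitary_diag U l)) delta eps).1 - S') <= delta /\
      (SGN u fp n (fl_shift fp mu (unitary_diag U l)) delta eps).2%:R
        <= cS * (sgn_iters (1 - g / 400) delta eps * T_MM n).
    (* The value [alpha = 1 - g / 400] is built from the true gap: it is not an input of SGN and
       serves only in its specification. *)
    apply: HS => //.
    + by rewrite d0.
    + by rewrite eps0 (le_lt_trans eps2 g16).
    + by rewrite subKr.
    + apply: le_trans (sgn_precision n1 g0 g2 d0 d12 eps1 eps2 cIb (Hmu n n0)).
      apply: le_trans bits _; rewrite ler_powR ?ler1n // lerN2 -/L1 -KE.
      apply: le_trans (ler_wpM2l C0 YX); apply: ler_wpM2r => //.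
      exact: mulr_ge0 Ln0 (mulr_ge0 (exprn_ge0 3 L10) (le_trans (ler0n _ 2) Ld2)).
  exists (fl_half_addI fp (SGN u fp n (fl_shift fp mu (unitary_diag U l)) delta eps).1,
    (c + n + 1 + (SGN u fp n (fl_shift fp mu (unitary_diag U l)) delta eps).2 + (n + 2 * n ^ 2))%N).
  split.
  + by exists mu, gap, c.
  + rewrite /Pk SE.
    have S'1 : opnorm S' <= 1.
      apply: (opnorm_unitary_diag Vu ler01) => i; rewrite mxE cabs_real normr_sg.
      by case: eqP; rewrite ?lexx ?ler01.
    exact: (density_accuracy fp g0 g2 dl1 ul1 nuD Tacc S'1 SS).
  + apply: (@le_trans _ _ (c2 * (T_MM n * (Lng ^+ 2 * L1 + log2 (log2 (delta * g)^-1))))).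
      rewrite c2E.
      apply: (density_cost_bound (r := (m + m).+1%:R)
        (N := sgn_iters (1 - g / 400) delta eps) (ltW cE0) cm0 (ltW cS0) n0 L11 Lng1 LLd0
        (HM n n0).1 mL _ _ Tcost); last exact: sgn_iters_le.
      (* The cost is summed over all [m + m + 1] possible rounds, each bounded by the worst
         logarithm [32 * Lng]. *)
      apply: (@le_trans _ _ (\sum_(0 <= r < (m + m).+1) ((eig r (fd r)).2 + 8))%N%:R).
        by rewrite ler_nat.
      rewrite natr_sum big_mkord -[X in X%:R * _]card_ord mulr_natl -sumr_const.
      apply: ler_sum => i _; rewrite natrD lerD2r.
      have [_ _ _ hc] := Hw i (ltn_ord i); apply: le_trans hc _.
      rewrite ler_wpM2l ?(ltW cE0) // ler_wpM2l //.
      have /andP[dL0 dL1] := dL i (ltn_ord i).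
      by rewrite ler_pXn2r // nnegrE // (le_trans dL0).
    apply: ler_wpM2r => //; rewrite mulr_ge0 //.
    exact: addr_ge0 (mulr_ge0 (exprn_ge0 2 Lng0) L10) LLd0.
- move=> t tm.
  have /andP[dL0 dL1] := dL t tm.
  apply: HE => //.
    by rewrite fermi_delta_gt0 //= fermi_delta_lt1.
  apply: le_trans bits _; rewrite ler_powR ?ler1n // lerN2.
  (* The fourth power of [log2 (n / fd t) <= 32 * Lng] produces the factor [32 ^+ 4] in [c1]. *)
  apply: (@le_trans _ _ (c1 * (Lng ^+ 4 * log2 n%:R))).
    have -> : c1 * (Lng ^+ 4 * log2 n%:R) = cE * ((32 * Lng) ^+ 4 * log2 n%:R).
      by rewrite c1E exprMn; move: (32 ^+ 4) (Lng ^+ 4) (log2 _) => x y z; ring.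
    apply: (ler_wpM2l (ltW cE0)); apply: (ler_wpM2r Ln0).
    by rewrite ler_pXn2r // nnegrE // (le_trans dL0).
  apply: le_trans (ler_wpM2l C0 ZX); apply: ler_wpM2r => //.
  exact: mulr_ge0 (exprn_ge0 4 Lng0) Ln0.
Qed.
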